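(* Let $G$ be a graph in $\mathcal{G}_0$, and let $u\in V(G)$. Then every edge of $G$ is contained in some induced cycle of length $5$, and $\delta(G)\ge 4$. Furthermore: (a) $G$ is $3$-connected; (b) $\{u,u_1,u_2,u_3\}$ is not a cutset of $G$ for any three vertices $u_1,u_2,u_3\in N(u)$; (c) every $3$-cutset of $G$ (vertex cutset of size $3$) is a stable set.
   Context: All graphs are finite and simple. A hole is an induced cycle of length at least $4$; an odd hole is a hole of odd length. $\mathcal{G}_2$ is the family of graphs of girth exactly $5$ having no odd holes of length at least $7$. $\mathcal{G}_0$ is the set of graphs $G\in\mathcal{G}_2$ with $\chi(G)=4$ such that every proper subgraph of $G$ is $3$-colorable. $\delta(G)$ is the minimum degree, $N(u)$ the neighborhood of $u$. A set is stable if it induces no edges. *)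

(* Defs.v *)
From mathcomp Require Import all_boot.

Set Implicit Arguments.
Unset Strict Implicit.
Unset Printing Implicit Defensive.

Record sgraph := SGraph {
  vertex :> finType;
  adj : rel vertex;
  adj_sym : symmetric adj;
  adj_irr : irreflexive adj }.

Record subgraph (G : sgraph) := Subgraph {
  sub_verts : {set G};
  sub_adj : rel G;
  sub_adj_sym : symmetric sub_adj;
  sub_adjP : forall x y, sub_adj x y ->
    [&& x \in sub_verts, y \in sub_verts & adj x y] }.

Section SubgraphAsGraph.
Variables (G : sgraph) (H : subgraph G).

Let sub_rel (x y : {x : G | x \in sub_verts H}) := sub_adj H (val x) (val y).

Fact sub_rel_sym : symmetric sub_rel.
Proof. by move=> x y; exact: sub_adj_sym. Qed.

Fact sub_rel_irr : irreflexive sub_rel.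
Proof. by move=> x; apply/negP => /sub_adjP; rewrite adj_irr !andbF. Qed.

Definition sgraph_of_subgraph : sgraph := SGraph sub_rel_sym sub_rel_irr.

Definition proper_subgraph : bool :=
  (sub_verts H != [set: G]) ||
  [exists x : G, exists y : G, adj x y && ~~ sub_adj H x y].

End SubgraphAsGraph.

Coercion sgraph_of_subgraph : subgraph >-> sgraph.

Section Induced.
Variables (G : sgraph) (A : {set G}).

Let ind_rel (x y : G) := [&& x \in A, y \in A & adj x y].

Fact ind_rel_sym : symmetric ind_rel.
Proof. by move=> x y; rewrite /ind_rel adj_sym andbCA. Qed.

Definition induced : subgraph G :=
  @Subgraph G A ind_rel ind_rel_sym (fun x y h => h).

End Induced.

Section Invariants.
Variable G : sgraph.

Definition colorable (k : nat) : bool :=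
  [exists c : {ffun G -> 'I_k},
    [forall x : G, forall y : G, adj x y ==> (c x != c y)]].

Fact ex_colorable : exists k, colorable k.
Proof.
exists #|G|; apply/existsP; exists [ffun x => enum_rank x].
apply/forallP => x; apply/forallP => y; apply/implyP => xy.
by rewrite !ffunE (inj_eq enum_rank_inj); apply: contraTneq xy => ->; rewrite adj_irr.
Qed.

Definition chromatic_number : nat := ex_minn ex_colorable.

Definition nbhd (u : G) : {set G} := [set v | adj u v].

(* The default value #|G| exceeds every degree, so it only matters when G has
   no vertices. *)
Definition min_degree : nat := \big[minn/#|G|]_(u : G) #|nbhd u|.

Definition stable (A : {set G}) : bool :=
  [forall x in A, forall y in A, ~~ adj x y].

(* A cycle is the sequence of its vertices, listed from any starting point and
   in either direction. *)
Definition is_cycle (c : seq G) : bool := (2 < size c) && ucycleb (@adj G) c.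

Definition cycle_edge (c : seq G) (x y : G) : bool :=
  [&& x \in c, y \in c & (y == next c x) || (x == next c y)].

Definition induced_cycle (c : seq G) : Prop :=
  is_cycle c /\ {in c &, forall x y, adj x y -> cycle_edge c x y}.

Definition hole (c : seq G) : Prop := induced_cycle c /\ 4 <= size c.

Definition odd_hole (c : seq G) : Prop := hole c /\ odd (size c).

Definition has_girth (g : nat) : Prop :=
  (exists2 c : seq G, is_cycle c & size c = g) /\
  (forall c : seq G, is_cycle c -> g <= size c).

(* Vacuously true of the graph without vertices. *)
Definition connected : Prop := forall x y : G, connect (@adj G) x y.

End Invariants.

Definition cutset (G : sgraph) (S : {set G}) : Prop :=
  ~ connected (induced (~: S)).

Definition k_connected (k : nat) (G : sgraph) : Prop :=
  k < #|G| /\ forall S : {set G}, #|S| < k -> connected (induced (~: S)).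

Definition G2 (G : sgraph) : Prop :=
  has_girth G 5 /\ ~ (exists2 c : seq G, odd_hole c & 7 <= size c).

Definition G0 (G : sgraph) : Prop :=
  [/\ G2 G, chromatic_number G = 4
    & forall H : subgraph G, proper_subgraph H -> colorable H 3].

(* Main.v *)
(* Every stable set [X] leaves a 5-cycle in [G - X]: otherwise [G - X] has no odd
   hole, hence is bipartite, and [X] is a third colour class.  Since 5-cycles are
   short and there are no 3- or 4-cycles, where this 5-cycle can lie is very
   restricted.

   - 3-colouring [G - xy] and removing a colour class not containing [x, y] puts
     a 5-cycle through [xy].
   - If [u] has at most three neighbours, colouring [G - u] and applying this to
     each pair of colours yields three 5-cycles through [u] whose union minus
     [u] is an induced 9-cycle.
   - For a separation [(A, B)], colourings of the two sides with a common colour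
     class on the separator can be glued unless a 5-cycle crosses the separator,
     which then holds two of its vertices with a common neighbour on one side.
     This rules out stars [u, u1, u2, ...] (the two vertices already have the
     common neighbour [u]) and pairs.
   - For a separator [x, y, z] with [x ~ y] and [z] adjacent to neither, a
     colouring of a side gives [z] the colour of [x], that of [y], or the third
     one.  Crossing 5-cycles give short paths between [z] and [x] or [y], and
     5-cycles in suitable unions of two colour classes of one side with such
     paths of the other side allow recolouring until the two sides agree or a
     long odd hole appears. *)
Require Import Defs.
From mathcomp Require Import all_boot.

Set Implicit Arguments.
Unset Strict Implicit.
Unset Printing Implicit Defensive.

(** * Odd closed walks *)

Section OddCycles.
Variables (T : finType) (e : rel T).
Hypotheses (e_sym : symmetric e) (e_irr : irreflexive e).

(** The bipartite double cover of [e]; the Boolean tracks the parity of the steps taken. *)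
Let lift_rel (u v : T * bool) := e u.1 v.1 && (v.2 == ~~ u.2).

Lemma lift_rel_path (u : T * bool) (p : seq (T * bool)) : path lift_rel u p ->
  path e u.1 (map fst p) /\ (last u p).2 = odd (size p) (+) u.2.
Proof.
elim: p u => [|v p IH] u //= /andP[/andP[euv /eqP v2] /IH[-> ->]].
by rewrite euv v2; case: (odd _) (u.2) => [] [].
Qed.

(* A colour class is the set of vertices joined to the root of their component
   by an even walk, found by reachability in the bipartite double cover. *)
Lemma bipartite_or_odd_closed_walk :
  (exists f : T -> bool, forall x y, e x y -> f x != f y) \/
  (exists c : seq T, cycle e c /\ odd (size c)).
Proof.
have l_sym : connect_sym lift_rel.
  apply: sym_connect_sym => u v.
  by rewrite /lift_rel e_sym; congr (_ && _); case: (u.2) (v.2) => [] [].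
have [/existsP[x]|no_odd] :=
  boolP [exists x, connect lift_rel (x, false) (x, true)].
  (* A path between the two copies of a vertex projects to an odd closed walk. *)
  case/connectP=> p /lift_rel_path[]; case/lastP: p => // p v.
  rewrite last_rcons map_rcons /= => wp v2 def_v; right; exists (x :: map fst p).
  by move: wp v2; rewrite -def_v /= size_rcons size_map /= addbF => -> <-.
left; pose r := root e.
have re x : connect e (r x) x by rewrite (@sym_connect_sym _ e) ?connect_root.
exists (fun x => connect lift_rel (r x, false) (x, true)) => x y exy.
have rxy : r x = r y.
  by apply/(rootP (sym_connect_sym e_sym)); apply: connect1.
have step b : connect lift_rel (r x, false) (x, b) ->
    connect lift_rel (r x, false) (y, ~~ b).
  by move/connect_trans; apply; apply: connect1; rewrite /lift_rel exy /=.
rewrite -rxy; apply/negP=> /eqP same.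
(* Suppose [x] and [y] get the same value. If both copies marked [true] are reached, the root
   reaches both copies of [y], which are then joined. If neither is, the root reaches no copy of
   [x], although a walk from the root to [x] lifts to one ending at such a copy. *)
have [xt|xt] := boolP (connect lift_rel (r x, false) (x, true)).
  have yt : connect lift_rel (r x, false) (y, true) by rewrite -same.
  have yf := step _ xt; case/negP: no_odd; apply/existsP; exists y.
  by apply: connect_trans yt; rewrite l_sym.
have xf : ~~ connect lift_rel (r x, false) (x, false).
  by apply: contra xt => /step; rewrite same.
have /connectP[p wp def_x] := re x.
have lift z b s : path e z s ->
    exists q, path lift_rel (z, b) q /\ (last (z, b) q).1 = last z s.
  elim: s z b => [|v s IH] z b /=; first by move=> _; exists [::].
  case/andP=> ezv /(IH _ (~~ b))[q [wq lq]]; exists ((v, ~~ b) :: q).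
  by rewrite /= /lift_rel ezv eqxx wq.
have [q [wq lq]] := lift _ false _ wp; rewrite -def_x in lq.
have : connect lift_rel (r x, false) (last (r x, false) q) by apply/connectP; exists q.
by case: (last _ q) lq => z [] /= ->; [move/(negP xt) | move/(negP xf)].
Qed.

(** Strong induction on the length: a repeated vertex or a chord splits the walk into two shorter
    closed walks, one of which is odd. *)
Lemma shortest_odd_closed_walk_induced (c : seq T) :
    cycle e c -> odd (size c) ->
  exists c' : seq T, [/\ ucycle e c', odd (size c') &
    {in c' &, forall x y, e x y -> (y == next c' x) || (x == next c' y)}].
Proof.
have [n] := ubnP (size c); elim: n c => // n IH c sz_c cyc_c odd_c.
have [uniq_c|/uniqPn] := boolP (uniq c); last first.
  have [x0 _] : exists x0, x0 \in c.
    by case: c odd_c {sz_c cyc_c} => // x0 c; exists x0; rewrite mem_head.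
  move=> /(_ x0)[i [j [lt_ij lt_j eq_ij]]].
  set x := nth x0 c i in eq_ij; pose p := drop i.+1 c ++ take i c.
  have lt_i := ltn_trans lt_ij lt_j.
  have rot_c : rot i c = x :: p by rewrite /rot (drop_nth x0 lt_i).
  have xp : x \in p.
    rewrite mem_cat eq_ij -[j](subnKC lt_ij) -nth_drop mem_nth //.
    by rewrite size_drop ltn_sub2r // (leq_ltn_trans lt_ij).
  move: cyc_c odd_c sz_c; rewrite -(rot_cycle i) -(size_rot i) rot_c.
  case/splitPr: xp => p1 p2; rewrite /= rcons_cat cat_path size_cat /=.
  case/andP=> wp1 /andP[ex wp2] odd_c lt_n.
  have cyc1 : cycle e (x :: p1) by rewrite /= rcons_path wp1.
  have cyc2 : cycle e (x :: p2) by [].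
  rewrite addnS /= oddD negbK in odd_c; have [odd1|odd1] := boolP (odd (size p2)).
    apply: (IH _ _ cyc1) => /=; last by rewrite odd1 addbT in odd_c.
    by rewrite ltnS in lt_n; apply: leq_ltn_trans lt_n; rewrite addnS ltnS leq_addr.
  apply: (IH _ _ cyc2) => //=.
  by rewrite ltnS in lt_n; apply: leq_ltn_trans lt_n; rewrite addnS ltnS leq_addl.
have [[x [y [xc yc exy]]] | good] : (exists x y, [/\ x \in c, y \in c &
    e x y && ~~ ((y == next c x) || (x == next c y))]) \/
    {in c &, forall x y, e x y -> (y == next c x) || (x == next c y)}.
- have [/allP good|/allPn[x xc /allPn[y yc bad]]] := boolP (all (fun x =>
      all (fun y => e x y ==> (y == next c x) || (x == next c y)) c) c).
    by right=> x y xc yc; apply/implyP; have /allP := good _ xc; apply.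
  by left; exists x, y; rewrite xc yc -negb_imply.
- case/andP: exy => exy; case: (rot_to xc) => i p rot_c.
  rewrite -!(next_rot i uniq_c) rot_c.
  have : uniq (x :: p) by rewrite -rot_c rot_uniq.
  move: yc cyc_c odd_c sz_c; rewrite -(mem_rot i) -(rot_cycle i) -(size_rot i) rot_c.
  rewrite inE; case: (eqVneq y x) => [yx|_ /=]; first by rewrite yx e_irr in exy.
  case/splitPr=> p1 p2; rewrite /= rcons_cat cat_path size_cat /=.
  case/and3P=> wp1 ep1 wp2 odd_c lt_n.
  rewrite mem_cat inE cat_uniq /= !negb_or => /and5P[/and3P[xp1 neq_xy xp2] uniq_p1].
  move=> /andP[yp1 _] yp2 _.
  case/andP=> nxt_x nxt_y.
  (* Since [x] and [y] are not consecutive, both arcs between them have inner vertices; this makes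
     either piece shorter than the whole cycle. *)
  have p1_gt0 : 0 < size p1 by case: (p1) nxt_x => //=; rewrite !eqxx.
  have p2_gt0 : 0 < size p2.
    case: (p2) nxt_y => //; suff -> z : y != z -> next_at y x z (p1 ++ [:: y]) = x.
    - by rewrite eqxx.
    - by rewrite eq_sym.
    elim: (p1) z yp1 => [|v p1' IHp] z /=; first by rewrite eqxx => _ /negPf->.
    by rewrite inE negb_or => /andP[yv /IHp IHy] /negPf->; exact: IHy.
  rewrite addnS /= oddD negbK in odd_c; rewrite addnS !ltnS in lt_n.
  have [odd1|odd1] := boolP (odd (size p2)).
    apply: (IH [:: x, y & p2]); rewrite //=.
      by apply: leq_ltn_trans lt_n; rewrite ltnS -add1n leq_add2r.
      by rewrite exy.
    by rewrite negbK.
  apply: (IH (x :: rcons p1 y)) => /=.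
  - by rewrite size_rcons; apply: leq_ltn_trans lt_n; rewrite ltnS -addn1 leq_add2l.
  - by rewrite !rcons_path wp1 ep1 last_rcons e_sym.
  - by rewrite size_rcons /= negbK; move: odd_c; rewrite (negPf odd1) addbF.
by exists c; rewrite /ucycle cyc_c uniq_c.
Qed.
End OddCycles.

(** * Girth five *)

Definition proper_on (G : sgraph) (C : eqType) (c : G -> C) (A : {set G}) : Prop :=
  {in A &, forall u v, adj u v -> c u != c v}.

Section Girth5.
Variable G : sgraph.
Implicit Types (A W : {set G}) (x y z m u v a b c d e : G).

Lemma adj_neq u v : adj u v -> u != v.
Proof. by apply: contraTneq => ->; rewrite adj_irr. Qed.

(** Positions turn chordlessness of an explicitly listed cycle into a finite check; with [i < j],
    the closing edge is the only exceptional pair. *)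
Lemma induced_cycle_nth x0 (c : seq G) : 2 < size c -> ucycle (@adj G) c ->
  (forall i j, i < j -> j < size c -> adj (nth x0 c i) (nth x0 c j) ->
     j = i.+1 \/ (i = 0 /\ j.+1 = size c)) ->
  induced_cycle c.
Proof.
move=> sz_c uc chordless; split; first by rewrite /is_cycle sz_c; apply/andP.
have uniq_c : uniq c by case/andP: uc.
have next_i i : i < size c ->
    next c (nth x0 c i) = if i.+1 < size c then nth x0 c i.+1 else nth x0 c 0.
  move=> lt_i; rewrite next_nth mem_nth //.
  case: c lt_i uniq_c {sz_c uc chordless} => // y p lt_i uniq_c.
  rewrite index_uniq //=; case: ltnP => hi; last by rewrite nth_default.
  by apply: set_nth_default.
have chord i j : i < j -> j < size c -> adj (nth x0 c i) (nth x0 c j) ->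
    (nth x0 c j == next c (nth x0 c i)) || (nth x0 c i == next c (nth x0 c j)).
  move=> lt_ij lt_j; have lt_i := ltn_trans lt_ij lt_j.
  case/(chordless _ _ lt_ij lt_j) => [->|[-> eq_j]].
    by rewrite next_i // (leq_ltn_trans lt_ij lt_j) eqxx.
  by rewrite [next c (nth _ _ j)]next_i // eq_j ltnn eqxx orbT.
move=> x y xc yc; rewrite /cycle_edge xc yc /=.
have := chord (index x c) (index y c); have := chord (index y c) (index x c).
rewrite !index_mem !nth_index //.
case: (ltngtP (index x c) (index y c)) => [_ _ /(_ isT yc)|_ /(_ isT xc) + _|] //.
  by rewrite orbC adj_sym.
by move/(congr1 (nth x0 c)); rewrite !nth_index // => ->; rewrite adj_irr.
Qed.

Hypothesis girth5 : has_girth G 5.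

Lemma triangle_free u v w : adj u v -> adj v w -> adj w u -> False.
Proof.
move=> uv vw wu; have /girth5.2 : is_cycle [:: u; v; w] => //.
rewrite /is_cycle /ucycleb /= uv vw wu !inE negb_or adj_neq //.
by rewrite (adj_neq vw) eq_sym adj_neq.
Qed.

Lemma common_nbr_uniq x y m m' : x != y ->
  adj x m -> adj m y -> adj x m' -> adj m' y -> m = m'.
Proof.
move=> xy xm my xm' m'y; apply/eqP/negPn/negP=> mm'.
have /girth5.2 : is_cycle [:: x; m; y; m'] => //.
rewrite /is_cycle /ucycleb /= xm my adj_sym m'y adj_sym xm' !inE !negb_or xy mm'.
by rewrite !adj_neq // adj_sym.
Qed.

(** Without triangles, a closed walk of length five has no repeated vertex and no chord, so the five
    adjacencies already describe an induced 5-cycle. *)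
Definition pent (a b c d e : G) : bool :=
  [&& adj a b, adj b c, adj c d, adj d e & adj e a].

Definition pent_in W a b c d e : Prop :=
  pent a b c d e /\ {subset [:: a; b; c; d; e] <= W}.

Lemma pent_rot W a b c d e : pent_in W a b c d e -> pent_in W b c d e a.
Proof.
case=> /and5P[ab bc cd de ea] sW; split; first by apply/and5P.
by move=> v hv; apply: sW; move: hv; rewrite !inE; case/or4P=> [||| /orP[]] ->; rewrite ?orbT.
Qed.

Lemma pent_rev W a b c d e : pent_in W a b c d e -> pent_in W a e d c b.
Proof.
case=> /and5P[ab bc cd de ea] sW.
split; first by apply/and5P; split; rewrite adj_sym.
by move=> v hv; apply: sW; move: hv; rewrite !inE; case/or4P=> [||| /orP[]] ->; rewrite ?orbT.
Qed.

Lemma pent_bip W a b c d e (f : G -> bool) :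
  pent_in W a b c d e -> proper_on f W -> False.
Proof.
case=> /and5P[ab bc cd de ea] sW pf.
have [aW bW cW dW eW] : [/\ a \in W, b \in W, c \in W, d \in W & e \in W].
  by split; apply: sW; rewrite !inE eqxx ?orbT.
move: (pf _ _ aW bW ab) (pf _ _ bW cW bc) (pf _ _ cW dW cd) (pf _ _ dW eW de) (pf _ _ eW aW ea).
by case: (f a) (f b) (f c) (f d) (f e) => [] [] [] [] [].
Qed.

Lemma pent_diag W a b c d e : pent_in W a b c d e -> a != c.
Proof.
case=> /and5P[ab bc cd de ea] _; apply/negP=> /eqP ac.
by apply: (triangle_free cd de); rewrite -ac.
Qed.

(** A 5-cycle missing [v] would be an odd cycle in the bipartite [W :\ v]; so [v] lies on it, and a
    rotation brings it to the front. *)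
Lemma pent_through W v (f : G -> bool) a b c d e :
    pent_in W a b c d e -> proper_on f (W :\ v) ->
  exists b' c' d' e', pent_in W v b' c' d' e'.
Proof.
move=> P pf; have [] := boolP (v \in [:: a; b; c; d; e]); last first.
  move=> vn; case: (@pent_bip (W :\ v) a b c d e f) => //.
  case: P => P sW; split=> // u uP; rewrite !inE sW // andbT.
  by apply: contraNneq vn => <-.
have P1 := pent_rot P; have P2 := pent_rot P1.
have P3 := pent_rot P2; have P4 := pent_rot P3.
rewrite !inE; case/or4P=> [||| /orP[]] /eqP->; do 4?eexists; eassumption.
Qed.

Lemma pent_induced W a b c d e : pent_in W a b c d e -> induced_cycle [:: a; b; c; d; e].
Proof.
move=> P; have P1 := pent_rot P; have P2 := pent_rot P1.
have P3 := pent_rot P2; have P4 := pent_rot P3.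
have chordless W' a' b' c' d' e' : pent_in W' a' b' c' d' e' -> adj a' c' -> False.
  by case=> /and5P[ab bc _ _ _] _; rewrite adj_sym; apply: triangle_free ab bc.
have /and5P[ab bc cd de ea] := P.1.
apply: (@induced_cycle_nth a) => //.
  rewrite /ucycle /= ab bc cd de ea /= !inE !negb_or.
  rewrite (pent_diag P) (pent_diag P1) (pent_diag P2) !(eq_sym _ e).
  rewrite [a == d]eq_sym (pent_diag P3) (pent_diag P4).
  by rewrite !adj_neq // adj_sym.
move=> [|[|[|[|i]]]] [|[|[|[|[|j]]]]] //= _ _; rewrite ?ltnS //;
 by [left | right | move/(chordless _ _ _ _ _ _ P) | move/(chordless _ _ _ _ _ _ P1) 
    | move/(chordless _ _ _ _ _ _ P2)
    | rewrite adj_sym => /(chordless _ _ _ _ _ _ P3)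
    | rewrite adj_sym => /(chordless _ _ _ _ _ _ P4)].
Qed.

End Girth5.

(** An odd closed walk inside [W] shrinks to an induced odd cycle. Girth five excludes length three,
    and the lack of long odd holes excludes seven and more. *)
Lemma bipartite_or_pent (G : sgraph) (hG : G2 G) (W : {set G}) :
  (exists f : G -> bool, proper_on f W) \/ (exists a b c d e, pent_in W a b c d e).
Proof.
case: hG => girth5 no_hole; pose e := sub_adj (induced W).
have e_sym : symmetric e by exact: sub_adj_sym.
have e_irr : irreflexive e by move=> x; rewrite /e /= adj_irr !andbF.
case: (bipartite_or_odd_closed_walk e_sym) => [[f pf]|[c [cyc_c odd_c]]].
  by left; exists f => u v uW vW uv; apply: pf; rewrite /e /= uW vW.
have [{cyc_c odd_c}c [/andP[cyc uniq_c] odd_c chordless]] :=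
  shortest_odd_closed_walk_induced e_sym e_irr cyc_c odd_c.
have cW x : x \in c -> x \in W by move/(next_cycle cyc) => /and3P[].
have sz_c : 2 < size c by case: c cyc odd_c {cW chordless uniq_c} => [|x [|y []]] //=; rewrite e_irr.
have uc : ucycle (@adj G) c.
  by rewrite /ucycle uniq_c andbT; apply: sub_cycle cyc => x y /and3P[].
have ind_c : induced_cycle c.
  split=> [|x y xc yc xy]; first by rewrite /is_cycle sz_c; apply/andP.
  by rewrite /cycle_edge xc yc chordless // /e /= !cW.
have ge5 : 5 <= size c by case: ind_c => /girth5.2.
have lt7 : size c < 7.
  rewrite ltnNge; apply/negP=> ge7; apply: no_hole; exists c => //.
  by split=> //; split=> //; apply: leq_trans ge5.
right; move: uc cW odd_c ge5 lt7.
case: c {cyc uniq_c chordless sz_c ind_c} => [|v0 [|v1 [|v2 [|v3 [|v4 [|v5 [|v6 c]]]]]]] //.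
rewrite /ucycle /= andbT => /andP[/and5P[h1 h2 h3 h4 h5] _] cW _ _ _.
by exists v0, v1, v2, v3, v4; split=> //; apply/and5P.
Qed.

(** * Colourings supplied by criticality *)

Section Critical.
Variable G : sgraph.
Hypothesis hG : G0 G.

Lemma G0_girth : has_girth G 5. Proof. by case: hG => -[]. Qed.

Lemma G0_not_3col (c : G -> 'I_3) : ~ proper_on c [set: G].
Proof.
move=> pc; case: hG => _ chi _; move: chi; rewrite /chromatic_number.
case: ex_minnP => m _ min_m def_m; rewrite def_m in min_m.
suff /min_m : colorable G 3 by [].
apply/existsP; exists [ffun x => c x]; apply/forallP=> x; apply/forallP=> y.
by apply/implyP=> xy; rewrite !ffunE; apply: pc; rewrite ?inE.
Qed.

Lemma G0_color_subgraph (H : subgraph G) : proper_subgraph H ->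
  exists c : G -> 'I_3, forall x y, sub_adj H x y -> c x != c y.
Proof.
case: hG => _ _ crit /crit/existsP[c /forallP pc].
(* Vertices outside [H] get the default colour [ord0]; no edge of [H] meets them. *)
exists (fun x => if insub x is Some w then c w else ord0) => x y xy.
have /and3P[xH yH _] := sub_adjP xy.
rewrite !insubT; move/forallP: (pc (Sub x xH)) => /(_ (Sub y yH))/implyP; apply.
exact: xy.
Qed.

Lemma G0_color_set (A : {set G}) : A != [set: G] -> exists c : G -> 'I_3, proper_on c A.
Proof.
move=> neA; have [|c pc] := @G0_color_subgraph (induced A).
  by rewrite /proper_subgraph /= neA.
by exists c => u v uA vA uv; apply: pc; rewrite /= uA vA.
Qed.

Lemma G0_color_edge x y : adj x y -> exists c : G -> 'I_3,
  forall u v, adj u v -> ~~ [|| (u == x) && (v == y) | (u == y) && (v == x)] -> c u != c v.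
Proof.
move=> xy.
pose e u v := adj u v && ~~ [|| (u == x) && (v == y) | (u == y) && (v == x)].
have e_sym : symmetric e.
  by move=> u v; rewrite /e adj_sym; congr (_ && ~~ _); rewrite orbC; congr (_ || _); rewrite andbC.
have eP u v : e u v -> [&& u \in [set: G], v \in [set: G] & adj u v].
  by rewrite !inE => /andP[].
have [|c pc] := @G0_color_subgraph (Subgraph e_sym eP).
  apply/orP; right; apply/existsP; exists x; apply/existsP; exists y.
  by rewrite xy /= /e !eqxx andbF.
by exists c => u v uv nuv; apply: pc; rewrite /= /e uv.
Qed.

End Critical.

(** * Long odd holes *)

(** Once colour [i] is excluded, two colours remain and must alternate along a path. *)
Lemma ord3_two_colors (i a b c : 'I_3) :
  a != i -> b != i -> c != i -> a != b -> b != c -> a = c.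
Proof.
move=> ai bi ci ab bc; apply/eqP; move: ai bi ci ab bc.
by case: i a b c => [[|[|[|?]]] ?] [[|[|[|?]]] ?] [[|[|[|?]]] ?] [[|[|[|?]]] ?].
Qed.

Lemma ord3_third (i j : 'I_3) : exists k : 'I_3, k != i /\ k != j.
Proof.
by case: i j => [[|[|[|?]]] ?] [[|[|[|?]]] ?] //;
  (exists (@Ordinal 3 0 isT) + exists (@Ordinal 3 1 isT) + exists (@Ordinal 3 2 isT)).
Qed.

Lemma proper_on_bool (G : sgraph) (c : G -> 'I_3) (W : {set G}) i :
    proper_on c W -> {in W, forall v, c v != i} ->
  exists f : G -> bool, proper_on f W.
Proof.
move=> pc ci; have [j [ji _]] := ord3_third i i; exists (fun v => c v == j) => u v uW vW uv.
have := pc _ _ uW vW uv; have := ci _ uW; have := ci _ vW => cvi cui; apply: contra => /eqP.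
case: eqP => [->|/eqP cuj] /esym; first by move/eqP->.
by move/negbT; rewrite eq_sym => jcv; apply/eqP; apply: (@ord3_two_colors i _ j).
Qed.

Lemma no_long_odd_hole (G : sgraph) (hG : G2 G) x0 (c : seq G) :
    6 < size c -> odd (size c) -> ucycle (@adj G) c ->
    (forall i j, i < j -> j < size c -> adj (nth x0 c i) (nth x0 c j) ->
       j = i.+1 \/ (i = 0 /\ j.+1 = size c)) ->
  False.
Proof.
move=> ge7 odd_c uc chordless; apply: hG.2; exists c => //; split=> //; split.
  by apply: induced_cycle_nth chordless => //; apply: leq_trans ge7.
by apply: leq_trans ge7.
Qed.

(** Adds the reverse of every adjacency, so that the closing tactics find short cycles in whichever
    orientation they occur. *)
Ltac sym_adj := repeat match goal with
  | H : is_true (adj ?x ?y) |- _ =>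
    lazymatch goal with
    | _ : is_true (adj y x) |- _ => fail
    | _ => have : is_true (adj y x) by [rewrite adj_sym]; intro
    end
  end.

Ltac by_color pc :=
  match goal with H : is_true (adj ?x ?y) |- _ =>
    let h := fresh in
    have h := pc x y; move: h => /(_ ltac:(assumption) ltac:(assumption) H)/eqP; congruence
  end.

Ltac by_triangle g5 :=
  match goal with
  | H : is_true (adj ?x ?y), H1 : is_true (adj ?y ?z), H2 : is_true (adj ?z ?x) |- _ =>
    case: (triangle_free g5 H H1 H2)
  end.

(* A 4-cycle [x y w z] whose diagonals [y z] are told apart by their colours
   and [x w] by a hypothesis. *)
Ltac by_square g5 :=
  match goal with
  | H : is_true (adj ?x ?y), H1 : is_true (adj ?y ?w), H3 : is_true (adj ?x ?z),
    H2 : is_true (adj ?z ?w), D : is_true (?x != ?w) |- _ =>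
    let h := fresh in have h := common_nbr_uniq g5 D H H1 H3 H2; congruence
  end.

Ltac by_nonadj :=
  match goal with
  | N : is_true (~~ adj ?x ?y), H : is_true (adj ?x ?y) |- _ => by case/negP: N
  end.

Section Holes.
Variable G : sgraph.
Hypothesis hG : G2 G.

(** Three two-coloured paths of length three between the neighbours [a], [b], [d] of [u] close up to
    a 9-cycle. A coincidence or chord is excluded by colours or creates a cycle of length at most
    four, often through [u]; so the 9-cycle is a long odd hole. *)
Lemma no_induced_nonagon u a p q b r s d t v (c : G -> 'I_3) :
    proper_on c (~: [set u]) ->
    adj u a -> adj u b -> adj u d ->
    adj a p -> adj p q -> adj q b -> adj b r -> adj r s -> adj s d ->
    adj d t -> adj t v -> adj v a ->
    all (mem (~: [set u])) [:: p; q; r; s; t; v] ->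
    c a != c b -> c b != c d -> c d != c a ->
    c p = c b -> c q = c a -> c r = c d -> c s = c b -> c t = c a -> c v = c d ->
  False.
Proof.
move=> pc ua ub ud ap pq qb br rs sd dt tv va.
have g5 := hG.1.
have : all (mem (~: [set u])) [:: a; b; d].
  by rewrite /= !inE ![_ == u]eq_sym !adj_neq.
have in_neq x : x \in ~: [set u] -> u != x by rewrite !inE eq_sym.
move=> /and4P[/= aD bD dD _] /and5P[/= pD qD rD sD /and3P[tD vD _]].
have [ua' ub' ud'] : [/\ u != a, u != b & u != d] by split; apply: in_neq.
have [up' uq' ur'] : [/\ u != p, u != q & u != r] by split; apply: in_neq.
have [us' ut' uv'] : [/\ u != s, u != t & u != v] by split; apply: in_neq.
move=> /eqP cab /eqP cbd /eqP cda cp cq cr cs ct cv.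
sym_adj.
have U : uniq [:: a; p; q; b; r; s; d; t; v].
  rewrite /= !inE !negb_or !andbT -!andbA.
  repeat (apply/andP; split); apply/eqP => E; try congruence;
  subst; solve [by_triangle g5 | by_square g5].
have sz : 6 < size [:: a; p; q; b; r; s; d; t; v] by [].
apply: (no_long_odd_hole hG (x0 := a) sz) => //.
  by rewrite /ucycle U /= ap pq qb br rs sd dt tv va.
move: U; rewrite /= !inE !negb_or -!andbA.
do ![case/andP=> ?] => _.
move=> [|[|[|[|[|[|[|[|i]]]]]]]] [|[|[|[|[|[|[|[|[|j]]]]]]]]] //= _ _ E;
  rewrite ?ltnS //; try by [left | right].
all: exfalso; sym_adj.
all: first [by_color pc | by_triangle g5 | by_square g5].
Qed.

(** The edge [xy] closes two alternating paths [x p q z] and [y r s z] to a 7-cycle. Colours, girth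
    and the nonadjacency of [z] to [x] and [y] exclude every coincidence and chord. *)
Lemma no_induced_heptagon x p q z s r y (B : {set G}) (c : G -> 'I_3) :
    proper_on c B -> all (mem B) [:: x; p; q; z; s; r; y] ->
    adj x p -> adj p q -> adj q z -> adj z s -> adj s r -> adj r y -> adj y x ->
    c x != c y -> c y != c z -> c z != c x ->
    c p = c z -> c q = c x -> c r = c z -> c s = c y ->
    ~~ adj x z -> ~~ adj y z ->
  False.
Proof.
move=> pc /and5P[/= xB pB qB zB /and4P[sB rB yB _]] xp pq qz zs sr ry yx.
have g5 := hG.1.
move=> /eqP cxy /eqP cyz /eqP czx cp cq cr cs nxz nyz.
sym_adj.
have U : uniq [:: x; p; q; z; s; r; y].
  rewrite /= !inE !negb_or !andbT -!andbA.
  repeat (apply/andP; split); apply/eqP => E; try congruence;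
  subst; solve [by_triangle g5 | by_square g5 | by_nonadj].
have sz : 6 < size [:: x; p; q; z; s; r; y] by [].
apply: (no_long_odd_hole hG (x0 := x) sz) => //.
  by rewrite /ucycle U /= xp pq qz zs sr ry yx.
move: U; rewrite /= !inE !negb_or -!andbA.
do ![case/andP=> ?] => _.
move=> [|[|[|[|[|[|i]]]]]] [|[|[|[|[|[|[|j]]]]]]] //= _ _ E;
  rewrite ?ltnS //; try by [left | right].
all: exfalso; sym_adj.
all: first [by_color pc | by_triangle g5 | by_square g5 | by_nonadj].
Qed.
End Holes.

(** * Edges and degrees *)

Section FiveCycles.
Variable G : sgraph.
Hypothesis hG : G0 G.
Let hG2 : G2 G. Proof. by case: hG. Qed.
Let girth5 : has_girth G 5 := hG2.1.

Lemma pent_off_stable (X : {set G}) :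
    {in X &, forall u v, ~~ adj u v} ->
  exists a b c d e, pent_in (~: X) a b c d e.
Proof.
move=> stX; case: (bipartite_or_pent hG2 (~: X)) => // -[f pf].
pose i0 : 'I_3 := @Ordinal 3 0 isT; pose i1 : 'I_3 := @Ordinal 3 1 isT.
pose i2 : 'I_3 := @Ordinal 3 2 isT.
case: (@G0_not_3col _ hG (fun v => if v \in X then i0 else if f v then i1 else i2)).
move=> u v _ _ uv; have [uX|uX] := boolP (u \in X); have [vX|vX] := boolP (v \in X).
- by rewrite (negPf (stX _ _ uX vX)) in uv.
- by case: (f v).
- by case: (f u).
- by have := pf u v; rewrite !inE => /(_ uX vX uv); case: (f u) (f v) => [] [].
Qed.

Lemma edge_in_pent x y : adj x y ->
  exists b c d, pent_in [set: G] x y b c d.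
Proof.
move=> xy; have [c pc] := G0_color_edge hG xy.
(* If the ends differed in colour, [c] would be a proper 3-colouring of [G]. *)
have cxy : c x = c y.
  apply/eqP/negPn/negP=> cxy; apply: (@G0_not_3col _ hG c) => u v _ _ uv.
  have [/orP[]/andP[/eqP-> /eqP->]|] := boolP ((u == x) && (v == y) || (u == y) && (v == x)).
  - by [].
  - by rewrite eq_sym.
  exact: pc.
have [i [ix _]] := ord3_third (c x) (c x).
have [a [b [d [e [g P]]]]] : exists a b d e g, pent_in (~: [set v | c v == i]) a b d e g.
  apply: pent_off_stable => u v; rewrite !inE => /eqP cu /eqP cv; apply/negP=> uv.
  have [ux uy] : u != x /\ u != y by split; apply: contraNneq ix => ux; rewrite -cu ux ?cxy.
  by have := pc u v uv; rewrite (negPf ux) (negPf uy) cu cv eqxx => /(_ isT).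
have not_i v : v \in ~: [set v | c v == i] -> c v != i by rewrite !inE.
(* The only badly coloured edge is [xy], so two colours suffice off [x] and the 5-cycle passes
   through [x]. *)
have [f pf] : exists f : G -> bool, proper_on f (~: [set v | c v == i] :\ x).
  apply: (@proper_on_bool _ c _ i) => [u v|v]; rewrite !inE; last by case/andP.
  case/andP=> ux _ /andP[vx _] uv; apply: pc => //.
  by rewrite (negPf ux) (negPf vx) andbF.
have [b' [d' [e' [g' {}P]]]] := pent_through P pf.
have [/and5P[xb bd de eg gx] sP] := P.
(* A 5-cycle without [y] would be properly coloured by the two remaining colours. With [y] on it,
   [y] is next to [x], since at distance two the edge [xy] would close a triangle. *)
have [yP|yP] := boolP (y \in [:: x; b'; d'; e'; g']); last first.
  have [f' pf'] : exists f : G -> bool, proper_on f [set v in [:: x; b'; d'; e'; g']].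
    apply: (@proper_on_bool _ c _ i) => [u v|v]; rewrite inE => uP; last exact/not_i/sP.
    rewrite inE => vP uv; apply: pc => //.
    have ne z : z \in [:: x; b'; d'; e'; g'] -> z == y = false.
      by move=> zP; apply: contraNF yP => /eqP<-.
    by rewrite !ne // andbF.
  case: (@pent_bip _ [set v in [:: x; b'; d'; e'; g']] x b' d' e' g' f') => //.
  by split; [apply/and5P | move=> v vP; rewrite in_set].
move: yP; rewrite !inE eq_sym (negPf (adj_neq xy)) /=; case/or4P=> /eqP def_y.
- by exists d', e', g'; rewrite def_y; split=> [|v _]; [apply/and5P | rewrite inE].
- by case: (triangle_free girth5 xb bd); rewrite -def_y adj_sym.
- by case: (triangle_free girth5 eg gx); rewrite -def_y.
- by exists e', d', b'; have := pent_rev P; rewrite def_y => -[? _]; split=> // v _; rewrite inE.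
Qed.

(** A colour missing from the neighbourhood could be given to [u], completing a 3-colouring of
    [G]. *)
Lemma color_nbr u (c : G -> 'I_3) : proper_on c (~: [set u]) ->
  forall i, exists2 v, adj u v & c v = i.
Proof.
move=> pc i; have [/existsP[v /andP[uv /eqP]]|none] :=
  boolP [exists v, adj u v && (c v == i)]; first by exists v.
case: (@G0_not_3col _ hG (fun v => if v == u then i else c v)) => v w _ _ vw.
have ci z : adj u z -> c z != i.
  by move=> uz; apply: contra none => /eqP cz; apply/existsP; exists z; rewrite uz cz eqxx.
case: (eqVneq v u) vw => [->|vu] vw; case: (eqVneq w u) vw => [->|wu] vw.
- by rewrite adj_irr in vw.
- by rewrite eq_sym ci.
- by rewrite ci // adj_sym.
- by apply: pc; rewrite ?inE.
Qed.

Lemma degree_ge4 (u : G) : 4 <= #|nbhd u|.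
Proof.
rewrite ltnNge; apply/negP=> deg3.
have [c pc] : exists c : G -> 'I_3, proper_on c (~: [set u]).
  by apply: (G0_color_set hG); apply/eqP=> /setP/(_ u); rewrite !inE eqxx.
have nbr := color_nbr pc.
(* All three colours occur on at most three neighbours, so no colour repeats. *)
have inj_c : {in nbhd u &, injective c}.
  apply/imset_injP; rewrite eqn_leq leq_imset_card (leq_trans deg3) //.
  have card3 : #|[set: 'I_3]| = 3 by rewrite cardsT card_ord.
  apply: leq_trans (_ : #|[set: 'I_3]| <= _); first by rewrite card3.
  apply/subset_leq_card/subsetP=> i _.
  by have [v uv <-] := nbr i; rewrite imset_f // inE.
(* The class of the third colour [k] is removed but [u] is kept whatever [c u] is, as [c] is proper
   only off [u]. The resulting 5-cycle passes through [u], and its neighbours there have the two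
   other colours, hence are [v] and [w]. *)
have link v w : adj u v -> adj u w -> c v != c w ->
    exists p q, [/\ [/\ adj v p, adj p q & adj q w],
      p \in ~: [set u], q \in ~: [set u], c p = c w & c q = c v].
  move=> uv uw cvw; have [k [kv kw]] := ord3_third (c v) (c w).
  have [a [b [d [e [g P]]]]] : exists a b d e g,
      pent_in (~: [set z | (z != u) && (c z == k)]) a b d e g.
    apply: pent_off_stable => y z; rewrite !inE => /andP[yu /eqP cy] /andP[zu /eqP cz].
    by apply/negP=> /(pc y z); rewrite !inE yu zu cy cz eqxx => /(_ isT isT).
  have [f pf] : exists f : G -> bool, proper_on f (~: [set z | (z != u) && (c z == k)] :\ u).
    apply: (@proper_on_bool _ c _ k) => [y z|y]; rewrite !inE.
      by case/andP=> yu _ /andP[zu _]; apply: pc; rewrite !inE.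
    by case/andP=> yu; rewrite yu.
  have {f pf P} [b' [p [q [e' P]]]] := pent_through P pf.
  have Wk z : z \in ~: [set z | (z != u) && (c z == k)] -> z != u -> c z != k.
    by rewrite !inE => + zu; rewrite zu.
  (* Reversing the 5-cycle makes [v] the successor of [u]. *)
  wlog def_b : b' p q e' P / b' = v.
    move=> IH; have [be Pr] := (pent_diag girth5 (pent_rot (pent_rot (pent_rot (pent_rot P)))), pent_rev P).
    have [/and5P[ub bp pq qe eu] sP] := P.
    rewrite adj_sym in eu.
    have cb : c b' != k by apply: Wk; [apply: sP; rewrite !inE eqxx ?orbT | rewrite eq_sym adj_neq].
    have ce : c e' != k by apply: Wk; [apply: sP; rewrite !inE eqxx ?orbT | rewrite eq_sym adj_neq].
    have [/inj_c bv|cbv] := eqVneq (c b') (c v); first by apply: IH P _; apply: bv; rewrite inE.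
    apply: IH Pr _; apply: (inj_c e' v); rewrite ?inE //.
    apply: (@ord3_two_colors k _ (c b')) => //; first by rewrite eq_sym.
    by apply: contra be => /eqP /inj_c ->; rewrite ?inE.
  rewrite {b'}def_b in P.
  have P1 := pent_rot P; have P2 := pent_rot P1; have P3 := pent_rot P2; have P4 := pent_rot P3.
  have [/and5P[_ vp pq qe eu] sP] := P; rewrite adj_sym in eu.
  have pu : p != u by rewrite eq_sym (pent_diag girth5 P).
  have qu : q != u by rewrite (pent_diag girth5 P3).
  have cp : c p != k by apply: Wk => //; apply: sP; rewrite !inE eqxx ?orbT.
  have cq : c q != k by apply: Wk => //; apply: sP; rewrite !inE eqxx ?orbT.
  have eU : e' != u by rewrite eq_sym adj_neq.
  have ce : c e' != k by apply: Wk => //; apply: sP; rewrite !inE eqxx ?orbT.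
  have vU : v != u by rewrite eq_sym adj_neq.
  have cvp : c v != c p by apply: pc; rewrite ?inE.
  have cpq : c p != c q by apply: pc; rewrite ?inE.
  have cqe : c q != c e' by apply: pc; rewrite ?inE.
  have cqv : c q = c v by apply: (@ord3_two_colors k _ (c p)); rewrite 1?eq_sym // eq_sym.
  have def_e : e' = w.
    apply: (inj_c e' w); rewrite ?inE //.
    by apply: (@ord3_two_colors k _ (c v)) => //; rewrite eq_sym // -cqv.
  exists p, q; rewrite !inE -def_e; split=> //.
  by apply: (@ord3_two_colors k _ (c q)); rewrite 1?eq_sym // eq_sym.
pose i0 : 'I_3 := @Ordinal 3 0 isT; pose i1 : 'I_3 := @Ordinal 3 1 isT.
pose i2 : 'I_3 := @Ordinal 3 2 isT.
have [[a ua ca] [b ub cb] [d ud cd]] := And3 (nbr i0) (nbr i1) (nbr i2).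
have [cab cbd cda] : [/\ c a != c b, c b != c d & c d != c a] by rewrite ca cb cd.
have [p [q [[ap pq qb] pU qU cp cq]]] := link _ _ ua ub cab.
have [r [s [[br rs sd] rU sU cr cs]]] := link _ _ ub ud cbd.
have [t [v [[dt tv va] tU vU ct cv]]] := link _ _ ud ua cda.
apply: (@no_induced_nonagon _ hG2 u a p q b r s d t v c) => //.
by rewrite /= pU qU rU sU tU vU.
Qed.

End FiveCycles.

(** * Separations *)

Section Separation.
Variable G : sgraph.
Implicit Types (A B W : {set G}).

(** The separator is [A :&: B]; that both sides are proper is stated separately where colourings of
    them are wanted. *)
Definition separation A B : Prop :=
  A :|: B = [set: G] /\ forall u v, u \notin B -> v \notin A -> ~~ adj u v.

Lemma separation_sym A B : separation A B -> separation B A.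
Proof. by case=> AB nAB; split=> [|u v uA vB]; rewrite (setUC, adj_sym) // nAB. Qed.

Lemma separation_side A B u : separation A B -> u \notin A -> u \in B.
Proof. by case=> /setP/(_ u); rewrite !inE => + _ => /orP[->|]. Qed.

Lemma separation_nbr A B u v : separation A B -> adj u v -> u \notin B -> v \in A.
Proof. by case=> _ nAB uv uB; apply: contraTT uv; apply: nAB. Qed.

(** Take [K] to be the component of some [x] in [G - S], with some [y] of [G - S] outside it. The
    sides are [S :|: K], which misses [y], and the complement of [K], which misses [x]. *)
Lemma cutset_separation (S : {set G}) : cutset S ->
  exists A B, [/\ separation A B, A :&: B = S, A != [set: G] & B != [set: G]].
Proof.
move=> cutS; pose H := induced (~: S).
have [/forallP all_c|] := boolP [forall x : H, forall y : H, connect (@adj H) x y].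
  by case: cutS => x y; apply/(forallP (all_c x)).
rewrite negb_forall => /existsP[x]; rewrite negb_forall => /existsP[y nxy].
pose K := [set v | if insub v is Some w then connect (@adj H) x w else false].
have KE (w : H) : (val w \in K) = connect (@adj H) x w by rewrite inE valK.
have KS v : v \in K -> v \notin S.
  by apply: contraL => vS; rewrite inE insubN // inE negbK.
clearbody K; exists (S :|: K), (~: K); split.
- split; first by apply/setP=> v; rewrite !inE; case: (v \in S) (v \in K) => [] [].
  move=> u v; rewrite !inE negbK negb_or => uK /andP[vS vK].
  apply: contra vK => uv; have uS := KS u uK.
  have uS' : u \in ~: S by rewrite inE uS.
  have vS' : v \in ~: S by rewrite inE.
  have {}uK : connect (@adj H) x (Sub u uS') by rewrite -KE.
  rewrite (KE (Sub v vS')); apply: connect_trans uK _.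
  by apply: connect1; rewrite /= uS' vS' uv.
- apply/setP=> v; rewrite in_setI in_setU in_setC.
  by have := KS v; case: (v \in S) (v \in K) => [] [] // /(_ isT).
- apply/eqP=> /setP/(_ (val y)); rewrite in_setU in_setT KE (negPf nxy) orbF => yS.
  by have := valP y; rewrite inE yS.
- apply/eqP=> /setP/(_ (val x)); rewrite in_setC in_setT KE connect0 //.
Qed.

Lemma pent_start W v a b c d e : pent_in W a b c d e -> v \in [:: a; b; c; d; e] ->
  exists b' c' d' e', pent_in W v b' c' d' e' /\
    {subset [:: a; b; c; d; e] <= [:: v; b'; c'; d'; e']}.
Proof.
move=> P; have P1 := pent_rot P; have P2 := pent_rot P1.
have P3 := pent_rot P2; have P4 := pent_rot P3.
rewrite !inE; case/or4P=> [||| /orP[]] /eqP->; do 4?eexists; split; try eassumption;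
  by move=> u; rewrite !inE; do 4?[case/orP]; move=> ->; rewrite ?orbT.
Qed.

(** A crossing 5-cycle meets the separator in two nonadjacent vertices [s] and [t], which cut it
    into a path [s m t] on one side and a path [t o n s] on the other. The cases start from a vertex
    [v] outside [B], whose two neighbours lie in [A]. *)
Lemma pent_crossing A B W a b c d e : separation A B -> pent_in W a b c d e ->
    ~ {subset [:: a; b; c; d; e] <= A} -> ~ {subset [:: a; b; c; d; e] <= B} ->
  exists s m t o n, [/\ pent_in W s m t o n, s \in A :&: B & t \in A :&: B] /\
    ([/\ m \in A, o \in B & n \in B] \/ [/\ m \in B, o \in A & n \in A]).
Proof.
move=> sAB P nA nB; have sBA := separation_sym sAB.
have [/allP//|/allPn[v vP vB]] := boolP (all (mem B) [:: a; b; c; d; e]).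
have [v1 [v2 [v3 [v4 [Q sPQ]]]]] := pent_start P vP.
have nQA : ~ {subset [:: v; v1; v2; v3; v4] <= A}.
  by move=> sQ; apply: nA => u /sPQ; apply: sQ.
have [/and5P[h0 h1 h2 h3 h4] _] := Q; rewrite adj_sym in h4.
have vA := separation_side sBA vB.
have v1A := separation_nbr sAB h0 vB; have v4A := separation_nbr sAB h4 vB.
have Q1 := pent_rot Q; have Q2 := pent_rot Q1.
have Q3 := pent_rot Q2; have Q4 := pent_rot Q3.
have [v2A|v2A] := boolP (v2 \in A); have [v3A|v3A] := boolP (v3 \in A).
- by case: nQA => u; rewrite !inE; do 4?[case/orP]; move/eqP->.
- have v4B := separation_nbr sBA h3 v3A.
  have v2B : v2 \in B by apply: separation_nbr sBA _ v3A; rewrite adj_sym.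
  exists v2, v3, v4, v, v1; rewrite !inE v2A v4A v4B v2B; split=> //; right.
  by split=> //; apply: separation_side sAB _.
- have v3B := separation_nbr sBA h2 v2A.
  have v1B : v1 \in B by apply: separation_nbr sBA _ v2A; rewrite adj_sym.
  exists v1, v2, v3, v4, v; rewrite !inE v1A v1B v3A v3B; split=> //; right.
  by split=> //; apply: separation_side sAB _.
- have v4B := separation_nbr sBA h3 v3A.
  have v1B : v1 \in B by apply: separation_nbr sBA _ v2A; rewrite adj_sym.
  exists v4, v, v1, v2, v3; rewrite !inE v1A v1B v4A v4B; split=> //; left.
  by split=> //; apply: separation_side sAB _.
Qed.

Definition bridge A B (a b : G -> 'I_3) i j s m t o n : Prop :=
  [/\ m \in A, o \in B & n \in B] /\
  [/\ a m != i, b o != j, b n != j, a s = a t & b s != b t].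

(** Off the classes [i] and [j] each side uses two colours. The path of length two in [A] then gives
    [s] and [t] equal colours, and the path of length three in [B] gives them different ones. *)
Lemma crossing_bridge A B (a b : G -> 'I_3) i j s m t o n :
    proper_on a A -> proper_on b B -> pent s m t o n ->
    {subset [:: s; t] <= A :&: B} -> [/\ m \in A, o \in B & n \in B] ->
    [/\ a s != i, a m != i & a t != i] ->
    [/\ b s != j, b n != j, b o != j & b t != j] ->
  bridge A B a b i j s m t o n.
Proof.
move=> pa pb /and5P[sm mt to on ns] ABst [mA oB nB] [as_ am at_] [bs bn bo bt].
have /setIP[sA sB] : s \in A :&: B by apply: ABst; rewrite inE eqxx.
have /setIP[tA tB] : t \in A :&: B by apply: ABst; rewrite !inE eqxx orbT.
split; split=> //.
  by apply: (@ord3_two_colors i _ (a m)) => //; apply: pa.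
have -> : b s = b o by apply: (@ord3_two_colors j _ (b n)) => //; rewrite eq_sym; apply: pb.
by rewrite eq_sym; apply: pb.
Qed.

Hypothesis hG : G0 G.
Let hG2 : G2 G. Proof. by case: hG. Qed.
Let girth5 : has_girth G 5 := hG2.1.

(** Classes that agree on the separator unite to a stable set [X]. A 5-cycle off [X] fits in neither
    side, since each side minus its class is 2-coloured; so it crosses. *)
Lemma bridge_of_common_class A B (a b : G -> 'I_3) i j :
    separation A B -> proper_on a A -> proper_on b B ->
    {in A :&: B, forall s, (a s == i) = (b s == j)} ->
  exists s m t o n, [/\ [/\ s \in A :&: B, t \in A :&: B, a s != i & a t != i],
    pent_in [set: G] s m t o n &
    bridge A B a b i j s m t o n \/ bridge B A b a j i s m t o n].
Proof.
move=> sAB pa pb eqS; have sBA := separation_sym sAB.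
pose X := [set v | if v \in A then a v == i else b v == j].
have XA v : v \in A -> (v \in X) = (a v == i) by move=> vA; rewrite inE vA.
have XB v : v \in B -> (v \in X) = (b v == j).
  by move=> vB; rewrite inE; case: ifP => // vA; apply: eqS; rewrite inE vA.
have nX v : v \in ~: X -> v \notin X by rewrite inE.
have [c1 [c2 [c3 [c4 [c5 P]]]]] : exists c1 c2 c3 c4 c5, pent_in (~: X) c1 c2 c3 c4 c5.
  apply: (pent_off_stable hG) => u v uX vX; apply/negP=> uv.
  (* Every edge lies within one side, where the colouring forbids it inside a class. *)
  have [/andP[uA vA]|] := boolP ((u \in A) && (v \in A)).
    move: uX vX (pa _ _ uA vA uv); rewrite !XA // => /eqP-> /eqP->.
    by rewrite eqxx.
  move=> nuv; have [uB vB] : u \in B /\ v \in B.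
    move: nuv; have st := separation_side sAB; have nb := separation_nbr sBA.
    rewrite negb_and; case/orP=> [uA|vA]; [have vB := nb _ _ uv uA | ].
      by split=> //; apply: st.
    by split; [apply: nb _ vA; rewrite adj_sym | apply: st].
  move: uX vX (pb _ _ uB vB uv); rewrite !XB // => /eqP-> /eqP->.
  by rewrite eqxx.
have [s [m [t [o [n [[Q sAB' tAB'] sides]]]]]] : exists s m t o n,
    [/\ pent_in (~: X) s m t o n, s \in A :&: B & t \in A :&: B] /\
    ([/\ m \in A, o \in B & n \in B] \/ [/\ m \in B, o \in A & n \in A]).
  apply: (pent_crossing sAB P) => sub.
  - have [f pf] : exists f : G -> bool, proper_on f (A :&: ~: X).
      apply: (@proper_on_bool _ a _ i) => [u v|v].
        by move=> /setIP[uA _] /setIP[vA _]; apply: pa.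
      by case/setIP=> vA; rewrite inE XA.
    apply: (pent_bip _ pf); split; first exact: P.1.
    by move=> v vP; rewrite inE sub //; apply: P.2.
  - have [f pf] : exists f : G -> bool, proper_on f (B :&: ~: X).
      apply: (@proper_on_bool _ b _ j) => [u v|v].
        by move=> /setIP[uB _] /setIP[vB _]; apply: pb.
      by case/setIP=> vB; rewrite inE XB.
    apply: (pent_bip _ pf); split; first exact: P.1.
    by move=> v vP; rewrite inE sub //; apply: P.2.
have [Qadj QX] := Q.
have [sX mX tX oX nX'] : [/\ s \notin X, m \notin X, t \notin X, o \notin X & n \notin X].
  by split; apply: nX; apply: QX; rewrite !inE eqxx ?orbT.
have /setIP[sA sB] := sAB'; have /setIP[tA tB] := tAB'.
have sub_st (D : {set G}) : s \in D -> t \in D -> {subset [:: s; t] <= D}.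
  by move=> sD tD v; rewrite !inE => /orP[]/eqP->.
exists s, m, t, o, n; split.
- by rewrite -!XA.
- by split=> // v _; rewrite inE.
case: sides => [[mA oB nB]|[mB oA nA]]; [left | right];
  apply: crossing_bridge => //; try exact: sub_st; try (by rewrite setIC; exact: sub_st);
  by split; rewrite -?XA -?XB.
Qed.

(** The classes of [u] meet the separator in [u] alone, so they agree there. The bridge joins two
    neighbours of [u], whose only common neighbour is [u]; then [m] is [u], against its colour. *)
Lemma star_not_separator A B u : separation A B -> A != [set: G] -> B != [set: G] ->
  u \in A :&: B -> {in A :&: B, forall s, s = u \/ adj u s} -> False.
Proof.
move=> sAB neA neB /setIP[uA uB] star.
have [a pa] := G0_color_set hG neA; have [b pb] := G0_color_set hG neB.
have eqS : {in A :&: B, forall s, (a s == a u) = (b s == b u)}.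
  move=> s sS; have /setIP[sA sB] := sS; case: (star s sS) => [->|us]; first by rewrite !eqxx.
  by rewrite [a s == _]eq_sym [b s == _]eq_sym (negPf (pa _ _ uA sA us)) (negPf (pb _ _ uB sB us)).
have [s [m [t [o [n [[sS tS as_ at_] P br]]]]]] := bridge_of_common_class sAB pa pb eqS.
have us : adj u s by case: (star s sS) as_ => // ->; rewrite eqxx.
have ut : adj u t by case: (star t tS) at_ => // ->; rewrite eqxx.
have [/and5P[sm mt _ _ _] _] := P.
rewrite adj_sym in us.
have um := common_nbr_uniq girth5 (pent_diag girth5 P) us ut sm mt.
by case: br => -[_ []]; rewrite -um eqxx.
Qed.

(** For each colour [i] other than [a x], the class [i] and the third class of [b] both miss the
    separator. As [b] tells [x] and [y] apart, the short path of the bridge is in [A]: a common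
    neighbour avoiding [i] and [a x]. Two choices of [i] give the same vertex, which then has no
    colour left. *)
Lemma pair_not_separator_diff A B x y (a b : G -> 'I_3) :
    separation A B -> A :&: B = [set x; y] ->
    proper_on a A -> proper_on b B -> a x = a y -> b x != b y -> False.
Proof.
move=> sAB defS pa pb axy bxy.
have mid i : i != a x -> exists m, [/\ adj x m, adj m y, a m != i & a m != a x].
  move=> ix; have [j [jx jy]] := ord3_third (b x) (b y).
  have eqS : {in A :&: B, forall s, (a s == i) = (b s == j)}.
    move=> s; rewrite defS !inE => /orP[]/eqP->; rewrite -?axy ![_ == i]eq_sym ![_ == j]eq_sym;
    by rewrite (negPf ix) ?(negPf jx) ?(negPf jy).
  have [s [m [t [o [n [[sS tS as_ at_] P br]]]]]] := bridge_of_common_class sAB pa pb eqS.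
  have st := pent_diag girth5 P; have [/and5P[sm mt _ _ _] _] := P.
  have /setIP[sA sB] := sS; have /setIP[tA tB] := tS.
  move: sS tS st; rewrite defS !inE.
  case: br => -[[mD _ _] [mi _ _ eq_st ne_st]]; last first.
    by case/orP=> /eqP def_s; case/orP=> /eqP def_t; rewrite def_s def_t ?eqxx // in eq_st *;
      move=> _; rewrite eq_st eqxx in bxy.
  have ms : a m != a s by rewrite eq_sym; apply: pa.
  case/orP=> /eqP def_s; case/orP=> /eqP def_t; rewrite def_s def_t ?eqxx // => _; exists m.
  - by rewrite -def_s -def_t.
  - by rewrite -def_s -def_t -eq_st ms adj_sym mt adj_sym sm.
have [i1 [i1x _]] := ord3_third (a x) (a x); have [i2 [i2x i21]] := ord3_third (a x) i1.
have [m1 [xm1 m1y m1i m1x]] := mid _ i1x; have [m2 [xm2 m2y m2i m2x]] := mid _ i2x.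
have xy : x != y by apply: contraNneq bxy => ->.
have m12 := common_nbr_uniq girth5 xy xm1 m1y xm2 m2y; subst m2.
by case/eqP: m2i; apply: (@ord3_two_colors (a x) _ i1); rewrite // eq_sym.
Qed.

(** If both colourings identify [x] and [y], or both distinguish them, the classes of [x] agree on
    the separator and leave at most one vertex of it, too few for a bridge. *)
Lemma pair_not_separator A B x y : separation A B -> A != [set: G] -> B != [set: G] ->
  x != y -> A :&: B = [set x; y] -> False.
Proof.
move=> sAB neA neB xy defS; have sBA := separation_sym sAB.
have [a pa] := G0_color_set hG neA; have [b pb] := G0_color_set hG neB.
have [axy|axy] := eqVneq (a x) (a y); have [bxy|bxy] := eqVneq (b x) (b y).
- have eqS : {in A :&: B, forall s, (a s == a x) = (b s == b x)}.
    by move=> s; rewrite defS !inE => /orP[]/eqP->; rewrite -?axy -?bxy !eqxx.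
  have [s [m [t [o [n [[]]]]]]] := bridge_of_common_class sAB pa pb eqS.
  by rewrite defS !inE => /orP[]/eqP->; rewrite -?axy eqxx.
- exact: pair_not_separator_diff sAB defS pa pb axy bxy.
- by rewrite setIC in defS; apply: pair_not_separator_diff sBA defS pb pa bxy axy.
have eqS : {in A :&: B, forall s, (a s == a x) = (b s == b x)}.
  move=> s; rewrite defS !inE => /orP[]/eqP->; first by rewrite !eqxx.
  by rewrite [a y == _]eq_sym [b y == _]eq_sym (negPf axy) (negPf bxy).
have [s [m [t [o [n [[sS tS as_ at_] P _]]]]]] := bridge_of_common_class sAB pa pb eqS.
have := pent_diag girth5 P; move: sS tS as_ at_; rewrite defS !inE.
by do 2![case/orP=> /eqP->]; rewrite ?eqxx.
Qed.

End Separation.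

(** * Separators of three vertices with one edge *)

(** Both functions flip at every step of a walk from [z], so each comparison with the value at [z]
    records the parity of that walk. *)
Lemma connect_parity (T : finType) (e : rel T) (f g : T -> bool) z :
    (forall u v, connect e z u -> e u v -> f u != f v) ->
    (forall u v, connect e z u -> e u v -> g u != g v) ->
  forall v, connect e z v -> (f z == f v) = (g z == g v).
Proof.
move=> ef eg v /connectP[p]; elim/last_ind: p v => [|p u IH] v /=.
  by move=> _ ->; rewrite !eqxx.
rewrite rcons_path last_rcons => /andP[wp eu] ->.
have zl : connect e z (last z p) by apply/connectP; exists p.
have := IH _ wp erefl; move: (ef _ _ zl eu) (eg _ _ zl eu).
by case: (f z) (g z) (f u) (g u) (f _) (g _) => [] [] [] [] [] [].
Qed.

Section EdgeTriple.
Variable G : sgraph.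
Hypothesis hG : G0 G.
Let hG2 : G2 G. Proof. by case: hG. Qed.
Let girth5 : has_girth G 5 := hG2.1.
Implicit Types (A B F : {set G}) (x y z w : G) (a b : G -> 'I_3).

Definition edge_triple A B x y z : Prop :=
  [/\ separation A B, A :&: B = [set x; y; z], adj x y, ~~ adj x z & ~~ adj y z].

Lemma edge_triple_swap_sides A B x y z : edge_triple A B x y z -> edge_triple B A x y z.
Proof. by case=> sAB defS xy xz yz; split=> //; [apply: separation_sym | rewrite setIC]. Qed.

Lemma edge_triple_swap_ends A B x y z : edge_triple A B x y z -> edge_triple A B y x z.
Proof.
by case=> sAB defS xy xz yz; split; rewrite // ?[adj y x]adj_sym // defS [ [set x; y] ]setUC.
Qed.

Lemma edge_triple_mem A B x y z : edge_triple A B x y z -> [/\ x \in A, y \in A & z \in A].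
Proof.
by case=> _ /setP defS _ _ _; split; [have := defS x | have := defS y | have := defS z];
  rewrite !inE eqxx ?orbT => /andP[].
Qed.

Lemma edge_triple_neq A B x y z : edge_triple A B x y z -> [/\ x != y, z != x & z != y].
Proof.
case=> _ _ xy xz yz; split; first exact: adj_neq.
  by apply: contraNneq yz => ->; rewrite adj_sym.
by apply: contraNneq xz => ->.
Qed.

Lemma edge_triple_sep A B x y z v : edge_triple A B x y z -> v \in A -> v \in B ->
  [\/ v = x, v = y | v = z].
Proof.
case=> _ /setP/(_ v) + _ _ _ vA vB; rewrite !inE vA vB.
by case/esym/orP=> [/orP[]|] /eqP; [apply: Or31 | apply: Or32 | apply: Or33].
Qed.

Lemma edge_triple_nbr A B x y z u v : edge_triple A B x y z -> adj u v ->
  u \notin A -> v \in A -> [\/ v = x, v = y | v = z].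
Proof.
move=> tri uv uA vA; apply: (edge_triple_sep tri vA).
by case: tri => /separation_sym sBA *; apply: separation_nbr sBA uv uA.
Qed.

(* A 5-cycle in the union of the two colour classes of [A] avoiding [w] with the
   path [x p q z] would need a second common neighbour of [x] and [z] besides
   [w]; so that union is bipartite, and its bipartition
   recolours [A] with [x] and [z] apart. *)
Lemma recolor_apart A B x y z a w p q : edge_triple A B x y z -> proper_on a A ->
    a x = a z -> w \in A -> adj x w -> adj w z ->
    p \notin A -> q \notin A -> adj x p -> adj p q -> adj q z ->
  exists a', [/\ proper_on a' A, {in A, forall v, (a' v == a w) = (a v == a w)}
    & a' x != a' z].
Proof.
move=> tri pa axz wA xw wz pA qA xp pq qz; set k := a w.
have [xA yA zA] := edge_triple_mem tri; have [xy zx zy] := edge_triple_neq tri.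
have [sAB defS xy_adj nxz nyz] := tri.
have xk : a x != k by apply: pa.
pose W := [set v in A | a v != k] :|: [set p; q].
have WA v : v \in W -> v \in A -> a v != k.
  rewrite !inE => + vA; rewrite vA /=; case/orP=> [//|/orP[]/eqP def_v].
    by rewrite def_v (negPf pA) in vA.
  by rewrite def_v (negPf qA) in vA.
have AW v : v \in A -> a v != k -> v \in W by move=> vA vk; rewrite !inE vA vk.
have WnA v : v \in W -> v \notin A -> v = p \/ v = q.
  by rewrite !inE => /orP[/andP[->]|/orP[]/eqP] //; [left | right].
have pW : p \in W by rewrite !inE eqxx orbT.
have qW : q \in W by rewrite !inE eqxx !orbT.
(* Both [p] and [q] meet [A] only through the separator, so girth five leaves [x] and [q] next to
   [p] in [W], and [z] and [p] next to [q]. *)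
have p_nbr v : v \in W -> adj p v -> v = x \/ v = q.
  move=> vW pv; have [vA|vA] := boolP (v \in A); last first.
    by case: (WnA _ vW vA) => def_v; [rewrite def_v adj_irr in pv | right].
  case: (edge_triple_nbr tri pv pA vA) => def_v; first by left.
    by rewrite def_v in pv; case: (triangle_free girth5 xp pv); rewrite adj_sym.
  rewrite def_v adj_sym in pv; by case: (triangle_free girth5 pq qz pv).
have q_nbr v : v \in W -> adj q v -> v = z \/ v = p.
  move=> vW qv; have [vA|vA] := boolP (v \in A); last first.
    by case: (WnA _ vW vA) => def_v; [right | rewrite def_v adj_irr in qv].
  case: (edge_triple_nbr tri qv qA vA) => def_v; last by left.
    by rewrite def_v in qv; case: (triangle_free girth5 xp pq qv).
  rewrite def_v in qv; have xq : x != q by apply: contraNneq qA => <-.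
  have yp : y = p by apply: (common_nbr_uniq girth5 xq) => //; rewrite adj_sym.
  by rewrite -yp yA in pA.
case: (bipartite_or_pent hG2 W) => [[f pf]|[c1 [c2 [c3 [c4 [c5 P]]]]]].
  have [l [lk lx]] := ord3_third k (a x).
  have xW : x \in W by apply: AW.
  have zW : z \in W by apply: AW; rewrite // -axz.
  have fz : (f z == f x) = false.
    move: (pf _ _ xW pW xp) (pf _ _ pW qW pq) (pf _ _ qW zW qz).
    by case: (f x) (f p) (f q) (f z) => [] [] [] [].
  exists (fun v => if a v == k then k else if f v == f x then a x else l); split.
  - move=> u v uA vA uv; have auv := pa _ _ uA vA uv.
    have other (c : bool) : (if c then a x else l) != k by case: c.
    have [au|au] := eqVneq (a u) k; have [av|av] := eqVneq (a v) k.
    + by rewrite au av eqxx in auv.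
    + by rewrite eq_sym other.
    + exact: other.
    have := pf _ _ (AW _ uA au) (AW _ vA av) uv.
    by case: (f u) (f v) (f x) => [] [] [] //=; rewrite eq_sym.
  - by move=> v vA /=; case: (eqVneq (a v) k); rewrite ?eqxx // => _; case: ifP => _; apply: negPf.
  - by rewrite (negPf xk) -axz (negPf xk) eqxx fz eq_sym.
have [g pg] : exists g : G -> bool, proper_on g [set v in A | a v != k].
  apply: (@proper_on_bool _ a _ k) => [u v|v]; rewrite !inE; last by case/andP.
  by move=> /andP[uA _] /andP[vA _]; apply: pa.
have gA u v : u \in W -> v \in W -> u \in A -> v \in A -> adj u v -> g u != g v.
  by move=> uW vW uA vA; apply: pg; rewrite !inE (uA, vA) WA.
(* Off [p], the vertex [q] hangs from [z] alone, so the bipartition of the two classes extends to it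
   and every 5-cycle of [W] uses [p]. *)
have pg' : proper_on (fun v => if v == q then ~~ g z else g v) (W :\ p).
  move=> u v /setD1P[up uW] /setD1P[vp vW] uv.
  case: (eqVneq u q) uv => [->|uq] uv; case: (eqVneq v q) uv => [->|vq] uv.
  - by rewrite adj_irr in uv.
  - by case: (q_nbr v vW uv) vp => ->; [case: (g z) | rewrite eqxx].
  - rewrite adj_sym in uv.
    by case: (q_nbr u uW uv) up => ->; [case: (g z) | rewrite eqxx].
  apply: gA => //; apply/negPn/negP.
    by move=> /(WnA u uW)[] def_u; [rewrite def_u eqxx in up | rewrite def_u eqxx in uq].
  by move=> /(WnA v vW)[] def_v; [rewrite def_v eqxx in vp | rewrite def_v eqxx in vq].
have [b [c [d [e {}P]]]] := pent_through P pg'.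
have stop (b' c' d' e' : G) : pent_in W p b' c' d' e' -> b' = q -> e' = x -> False.
  move=> Q bq ex; have Q1 := pent_rot Q; have [/and5P[_ bc cd de _] sQ] := Q.
  have [cW dW] : c' \in W /\ d' \in W by split; apply: sQ; rewrite !inE eqxx ?orbT.
  rewrite bq in bc; case: (q_nbr c' cW bc) => def_c.
    rewrite def_c in cd; rewrite ex in de.
    have wd : w = d'.
      by apply: (common_nbr_uniq girth5 _ xw wz) => //; rewrite 1?eq_sym // adj_sym.
    by have := WA d' dW; rewrite -wd wA eqxx => /(_ isT).
  by have := pent_diag girth5 Q; rewrite def_c eqxx.
have [/and5P[pb _ _ _ ep] sP] := P; rewrite adj_sym in ep.
have [bW eW] : b \in W /\ e \in W by split; apply: sP; rewrite !inE eqxx ?orbT.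
have eb := pent_diag girth5 (pent_rot (pent_rot (pent_rot (pent_rot P)))).
case: (p_nbr b bW pb) => def_b; case: (p_nbr e eW ep) => def_e.
- by rewrite def_b def_e eqxx in eb.
- by case: (stop _ _ _ _ (pent_rev P)).
- by case: (stop _ _ _ _ P).
- by rewrite def_b def_e eqxx in eb.
Qed.

(** The classes of [y] meet the separator in [y] alone on both sides, so a bridge joins [x] and [z].
    Since [b] tells these apart, its short path lies in [A] and its long one in [B]. *)
Lemma links_of_same_and_rainbow A B x y z a b : edge_triple A B x y z ->
    proper_on a A -> proper_on b B -> a x = a z -> b z != b x -> b z != b y ->
  exists w p q, [/\ [/\ w \in A, adj x w, adj w z & a w != a y],
    [/\ p \notin A, q \notin A, p \in B & q \in B],
    [/\ adj x p, adj p q & adj q z] & b p != b y /\ b q != b y].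
Proof.
move=> tri pa pb axz bzx bzy.
have [xA yA zA] := edge_triple_mem tri; have [xy zx zy] := edge_triple_neq tri.
have [xB yB zB] := edge_triple_mem (edge_triple_swap_sides tri).
have [sAB defS xy_adj nxz nyz] := tri.
have axy : a x != a y by apply: pa.
have bxy : b x != b y by apply: pb.
have eqS : {in A :&: B, forall s, (a s == a y) = (b s == b y)}.
  move=> s; rewrite defS !inE -orbA => /or3P[]/eqP->; rewrite ?eqxx -?axz //.
    by rewrite (negPf axy) (negPf bxy).
  by rewrite (negPf axy) (negPf bzy).
have [s [m [t [o [n [[sS tS as_ at_] P br]]]]]] := bridge_of_common_class hG sAB pa pb eqS.
have st := pent_diag girth5 P; have [/and5P[sm mt to on ns] _] := P.
have notA v : v \in B -> b v != b y -> adj v x || adj v z -> v \notin A.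
  move=> vB vy vxz; apply/negP=> vA; case: (edge_triple_sep tri vA vB) => def_v.
  - by move: vxz nxz; rewrite def_v adj_irr /= => ->.
  - by rewrite def_v eqxx in vy.
  - by move: vxz nxz; rewrite def_v adj_irr orbF adj_sym => ->.
have xz_of v : v \in A :&: B -> a v != a y -> v = x \/ v = z.
  rewrite defS !inE -orbA => /or3P[]/eqP-> //; [by left | by rewrite eqxx | by right].
case: br => -[[mD oD nD] [mi oj nj eq_st ne_st]]; last first.
  case: (xz_of s sS as_) eq_st st => ->; case: (xz_of t tS at_) => ->; rewrite ?eqxx // => eq_b _.
    by rewrite eq_b eqxx in bzx.
  by rewrite eq_b eqxx in bzx.
case: (xz_of s sS as_) sm ns st => ->; case: (xz_of t tS at_) mt to => -> mt to sm ns.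
- by rewrite eqxx.
- exists m, n, o; have xn : adj x n by rewrite adj_sym.
  have oz : adj o z by rewrite adj_sym.
  by split; split; rewrite // ?(adj_sym n o) // notA // ?ns ?oz ?orbT.
- exists m, o, n; have xm : adj x m by rewrite adj_sym.
  have mz : adj m z by rewrite adj_sym.
  have ox : adj o x by rewrite adj_sym.
  by split; split; rewrite // notA // ?ns ?ox ?orbT.
- by rewrite eqxx.
Qed.

(** One link from [x] to [z] in [B] lets [A] be recoloured so that [z] agrees with [y] instead of
    [x]. By symmetry this yields a link from [y] to [z], and both links with the edge [xy] form the
    forbidden heptagon. *)
Lemma same_rainbow_absurd A B x y z a b : edge_triple A B x y z ->
  proper_on a A -> proper_on b B -> a x = a z -> b z != b x -> b z != b y -> False.
Proof.
move=> tri pa pb axz bzx bzy.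
have [w [p [q [[wA xw wz wy] [pA qA pB qB] [xp pq qz] [py qy]]]]] :=
  links_of_same_and_rainbow tri pa pb axz bzx bzy.
have [xA yA zA] := edge_triple_mem tri; have [xy zx zy] := edge_triple_neq tri.
have [xB yB zB] := edge_triple_mem (edge_triple_swap_sides tri).
have [_ _ xy_adj nxz nyz] := tri; have bxy : b x != b y by apply: pb.
have [a' [pa' class_a' a'xz]] := recolor_apart tri pa axz wA xw wz pA qA xp pq qz.
have a'yz : a' y = a' z.
  have in_k v : v \in A -> a v != a w -> a' v != a w by move=> vA; rewrite class_a'.
  apply: (@ord3_two_colors (a w) _ (a' x)) => //.
  - by apply: in_k; rewrite // eq_sym.
  - by apply: in_k => //; apply: pa.
  - by apply: in_k => //; rewrite eq_sym; apply: pa.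
  - by rewrite eq_sym; apply: pa'.
have [w' [r [s [_ [rA sA rB sB] [yr rs sz] [rx sx]]]]] :=
  links_of_same_and_rainbow (edge_triple_swap_ends tri) pa' pb a'yz bzy bzx.
have [bxp bpq bqz] : [/\ b x != b p, b p != b q & b q != b z] by split; apply: pb.
have [byr brs bsz] : [/\ b y != b r, b r != b s & b s != b z] by split; apply: pb.
apply: (@no_induced_heptagon _ hG2 x p q z s r y B b) => //; rewrite 1?adj_sym //.
- by rewrite /= xB pB qB zB sB rB yB.
- by rewrite eq_sym.
- by apply: (@ord3_two_colors (b y) _ (b q)).
- by apply: (@ord3_two_colors (b y) _ (b p)) => //; rewrite eq_sym.
- apply: (@ord3_two_colors (b x) _ (b s)) => //.
- by apply: (@ord3_two_colors (b x) _ (b r)) => //; rewrite eq_sym.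
Qed.

(** What remains is that both sides give [x], [y], [z] three colours. With the classes of [x]
    matched, a bridge joins [y] and [z], yet neither side colours them alike. *)
Lemma rainbow_absurd A B x y z a b : edge_triple A B x y z ->
  proper_on a A -> proper_on b B -> b z != b x -> b z != b y -> False.
Proof.
move=> tri pa pb bzx bzy.
have [axz|axz] := eqVneq (a x) (a z).
  exact: (same_rainbow_absurd tri pa pb).
have [ayz|ayz] := eqVneq (a y) (a z).
  exact: (same_rainbow_absurd (edge_triple_swap_ends tri) pa pb).
have [xA yA zA] := edge_triple_mem tri.
have [xB yB zB] := edge_triple_mem (edge_triple_swap_sides tri).
have [sAB defS xy_adj _ _] := tri.
have axy : a x != a y by apply: pa.
have bxy : b x != b y by apply: pb.
have eqS : {in A :&: B, forall s, (a s == a x) = (b s == b x)}.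
  move=> s; rewrite defS !inE -orbA => /or3P[]/eqP->; rewrite ?eqxx //.
    by rewrite [a y == _]eq_sym [b y == _]eq_sym (negPf axy) (negPf bxy).
  by rewrite [a z == _]eq_sym (negPf axz) (negPf bzx).
have [s [m [t [o [n [[sS tS as_ at_] P br]]]]]] := bridge_of_common_class hG sAB pa pb eqS.
have st := pent_diag girth5 P.
have yz_of v : v \in A :&: B -> a v != a x -> v = y \/ v = z.
  rewrite defS !inE -orbA => /or3P[]/eqP-> //; [by rewrite eqxx | by left | by right].
by case: br => -[_ [_ _ _ + _]]; case: (yz_of s sS as_) st => ->; case: (yz_of t tS at_) => ->;
  rewrite ?eqxx // => _ /eqP; rewrite 1?eq_sym ?(negPf ayz) ?(negPf bzy) // eq_sym ?(negPf ayz) ?(negPf bzy).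
Qed.

(** Recolouring keeps the class of [w], which contains [y] but not [z], and separates [x] from [z];
    so [A] now shows three colours on the separator. *)
Lemma middle_and_link_absurd A B x y z a b w p q : edge_triple A B x y z ->
    proper_on a A -> proper_on b B -> a x = a z ->
    w \in A -> adj x w -> adj w z -> a w = a y ->
    p \notin A -> q \notin A -> adj x p -> adj p q -> adj q z -> False.
Proof.
move=> tri pa pb axz wA xw wz wy pA qA xp pq qz.
have [a' [pa' class_a' a'xz]] := recolor_apart tri pa axz wA xw wz pA qA xp pq qz.
have [xA yA zA] := edge_triple_mem tri.
apply: (rainbow_absurd (edge_triple_swap_sides tri) pb pa'); first by rewrite eq_sym.
have /eqP-> : a' y == a w by rewrite class_a' // wy.
by rewrite class_a' // eq_sym; apply: pa.
Qed.

(* A bipartite part of the side [A], disjoint from [N(x)] except for [y], in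
   which [y] and [z] are joined by an even path. *)
Definition strip A x y z w F : Prop :=
  [/\ F \subset A, [/\ y \in F, z \in F, x \notin F & w \notin F],
      {in F, forall v, adj x v -> v = y},
      forall v1 v2 v3 v4 v5 : G, ~ pent_in F v1 v2 v3 v4 v5
    & forall f : G -> bool, proper_on f F -> f y = f z].

(** If the two classes avoiding [a y] do not connect [z] to [x], a Kempe swap at [z] gives the first
    case. Otherwise the component of [z] away from the neighbours of [y] touches such a neighbour
    [t], and the parity of [t] decides between the other two. *)
Lemma side_cases A B x y z a w w' : edge_triple A B x y z -> proper_on a A ->
    a x = a z -> w \in A -> adj x w -> adj w z -> a w = a y ->
    w' \notin A -> adj y w' -> adj w' z ->
  [\/ exists a', [/\ proper_on a' A, a' z != a' x & a' z != a' y],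
      exists p q, [/\ p \notin B, q \notin B, adj y p, adj p q & adj q z]
    | exists F, strip A x y z w F].
Proof.
move=> tri pa axz wA xw wz wy w'A yw' w'z.
have [xA yA zA] := edge_triple_mem tri; have [xy zx zy] := edge_triple_neq tri.
have [sAB defS xy_adj nxz nyz] := tri.
have axy : a x != a y by apply: pa.
pose U := [set v in A | a v != a y].
pose eU u v := [&& u \in U, v \in U & adj u v].
pose U0 := U :\: nbhd y.
pose e0 u v := [&& u \in U0, v \in U0 & adj u v].
have xU : x \in U by rewrite inE xA.
have zU : z \in U by rewrite inE zA -axz.
have yU : y \notin U by rewrite inE eqxx andbF.
have zU0 : z \in U0 by rewrite in_setD zU inE nyz.
have UA v : v \in U -> v \in A by rewrite inE => /andP[].
have [l [lx ly]] := ord3_third (a x) (a y).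
have Ucol v : v \in U -> a v != a x -> a v = l.
  rewrite inE => /andP[_ vy] vx; apply: (@ord3_two_colors (a y) _ (a x)) => //.
  by rewrite eq_sym.
have [zx_conn|not_conn] := boolP (connect eU z x); last first.
  (* The swap on the component [K] of [z] leaves [x] and [y] fixed and gives [z] the third colour
     [l]. *)
  apply: Or31; pose K := [set v | connect eU z v].
  have KU v : v \in K -> v \in U.
    rewrite inE => /(closed_connect (a := U))<- //.
    by move=> u1 u2 /and3P[-> ->].
  have Kstep u v : u \in K -> v \in U -> adj u v -> v \in K.
    move=> uK vU uv; have := uK; rewrite !inE => zu; apply: connect_trans zu (connect1 _).
    by rewrite /eU KU // vU.
  have zK : z \in K by rewrite inE connect0.
  have xK : x \notin K by rewrite inE.
  have yK : y \notin K by apply: contra yU; apply: KU.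
  exists (fun v => if v \in K then (if a v == a x then l else a x) else a v); split.
  - have cross u v : u \in A -> v \in A -> adj u v -> u \in K -> v \notin K ->
        (if a u == a x then l else a x) != a v.
      move=> uA vA uv uK vK; have -> : a v = a y.
        by apply/eqP; apply: contraR vK => vy; apply: Kstep uK _ uv; rewrite inE vA.
      by case: ifP.
    move=> u v uA vA uv; have auv := pa _ _ uA vA uv.
    have [uK|uK] := boolP (u \in K); have [vK|vK] := boolP (v \in K) => //.
    + have [ux|ux] := eqVneq (a u) (a x); have [vx|vx] := eqVneq (a v) (a x) => //.
      * by rewrite ux vx eqxx in auv.
      * by rewrite eq_sym.
      * by rewrite (Ucol u (KU u uK) ux) (Ucol v (KU v vK) vx) eqxx in auv.
    + exact: cross.
    + by rewrite eq_sym; apply: cross => //; rewrite adj_sym.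
  - by rewrite zK (negPf xK) -axz eqxx.
  - by rewrite zK (negPf yK) -axz eqxx.
pose K0 := [set v | connect e0 z v].
have K0U0 v : v \in K0 -> v \in U0.
  rewrite inE => /(closed_connect (a := U0))<- //.
  by move=> u1 u2 /and3P[-> ->].
have zK0 : z \in K0 by rewrite inE connect0.
have K0U v : v \in K0 -> v \in U by move/K0U0/setDP=> [].
have K0y v : v \in K0 -> ~~ adj y v by move/K0U0/setDP=> [_]; rewrite inE.
have K0step u v : u \in K0 -> v \in U0 -> adj u v -> v \in K0.
  move=> uK vU uv; have := uK; rewrite !inE => zu; apply: connect_trans zu (connect1 _).
  by rewrite /e0 K0U0 // vU.
pose g v := a v == a x.
have gU u v : u \in U -> v \in U -> adj u v -> g u != g v.
  move=> uU vU uv; have auv := pa _ _ (UA _ uU) (UA _ vU) uv; rewrite /g.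
  have [ux|ux] := eqVneq (a u) (a x); have [vx|vx] := eqVneq (a v) (a x) => //.
    by rewrite ux vx eqxx in auv.
  by rewrite (Ucol u uU ux) (Ucol v vU vx) eqxx in auv.
have gz : g z by rewrite /g -axz.
have parity (f : G -> bool) (W : {set G}) c : proper_on f W -> K0 \subset W -> c \in K0 ->
    (f z == f c) = g c.
  move=> pf /subsetP sKW cK.
  have -> : g c = (g z == g c) by rewrite gz; case: (g c).
  apply: (@connect_parity _ e0); last by rewrite inE in cK.
    move=> u v zu /and3P[uU vU uv]; have uK : u \in K0 by rewrite inE.
    by apply: pf => //; apply: sKW => //; apply: K0step uK _ _.
  move=> u v _ /and3P[/setDP[uU _] /setDP[vU _] uv]; exact: gU.
(* The walk from [z] to [x] must leave [K0], as [x] is adjacent to [y]; it leaves through a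
   neighbour [t] of [y]. *)
have [t [c [tU yt cK ct]]] : exists t c, [/\ t \in U, adj y t, c \in K0 & adj c t].
  have [/existsP[t /existsP[c /and4P[]]]|none] :=
    boolP [exists t, exists c, [&& t \in U, adj y t, c \in K0 & adj c t]].
    by exists t, c.
  have clK : closed eU (mem K0).
    apply: intro_closed => [|u v /and3P[uU vU uv] uK].
      by apply: sym_connect_sym => u v; rewrite /eU adj_sym andbCA.
    apply: (K0step u) => //; rewrite in_setD vU inE andbT.
    apply: contra none => yv; apply/existsP; exists v; apply/existsP; exists u.
    by rewrite vU yv uv (_ : u \in K0).
  have : x \in mem K0 by rewrite -(closed_connect clK zx_conn).
  by move/K0y; rewrite adj_sym xy_adj.
have [/existsP[t' /existsP[c' /and5P[]]]|none] := boolP [exists t, exists c,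
    [&& t \in U, adj y t, c \in K0, adj c t & g t]].
- move: t' c' {t c tU yt cK ct} => t c tU yt cK ct gt; have tA := UA t tU.
  (* Here [t] is at even distance from [z] through [K0], and [t y w' z] has length three, so [W] is
     not bipartite. A 5-cycle in it must be [y t p z w']. *)
  apply: Or32; pose W := K0 :|: [set y; t; w'].
  have K0W : K0 \subset W by apply: subsetUl.
  have [yW tW w'W] : [/\ y \in W, t \in W & w' \in W].
    by rewrite !in_setU !in_set1 !eqxx ?orbT.
  have W_cases v : v \in W -> [\/ v \in K0, v = y, v = t | v = w'].
    rewrite !in_setU !in_set1 => /orP[vK|/orP[/orP[]|] /eqP]; first exact: Or41.
    + exact: Or42.
    + exact: Or43.
    + exact: Or44.
  have w'_nbr v : v \in W -> adj w' v -> v = y \/ v = z.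
    move=> vW w'v; have [vA|vA] := boolP (v \in A); last first.
      case: (W_cases v vW) => def_v; try by rewrite ?def_v ?yA ?tA ?(UA v (K0U v def_v)) in vA.
      by rewrite def_v adj_irr in w'v.
    case: (edge_triple_nbr tri w'v w'A vA) => def_v; [|by left|by right].
    rewrite def_v adj_sym in w'v; case: (triangle_free girth5 yw' _ xy_adj).
    by rewrite adj_sym.
  have y_nbr v : v \in W -> adj y v -> v = t \/ v = w'.
    move=> /W_cases[vK|->|->|->] yv; [|by rewrite adj_irr in yv|by left|by right].
    by rewrite (negPf (K0y v vK)) in yv.
  case: (bipartite_or_pent hG2 W) => [[f pf]|[v1 [v2 [v3 [v4 [v5 P]]]]]].
    have cW := subsetP K0W c cK; have zW := subsetP K0W z zK0.
    have := gU c t (K0U c cK) tU ct; rewrite gt eqb_id => gc.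
    move: (parity f W c pf K0W cK) (pf _ _ cW tW ct) (pf _ _ yW tW yt)
      (pf _ _ yW w'W yw') (pf _ _ w'W zW w'z).
    rewrite (negPf gc).
    by case: (f z) (f c) (f t) (f y) (f w') => [] [] [] [] [].
  have pg : proper_on (fun v => if v == w' then false else g v) (W :\ y).
    move=> u v /setD1P[uy uW] /setD1P[vy vW] uv.
    have inU i : i \in W -> i != y -> i != w' -> i \in U.
      by move=> /W_cases[/K0U|->|->|->]; rewrite ?eqxx.
    case: (eqVneq u w') uv => [->|uw] uv; case: (eqVneq v w') uv => [->|vw] uv.
    + by rewrite adj_irr in uv.
    + by case: (w'_nbr v vW uv) vy => ->; rewrite ?eqxx // gz.
    + rewrite adj_sym in uv.
      by case: (w'_nbr u uW uv) uy => ->; rewrite ?eqxx // gz.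
    + by apply: gU => //; apply: inU.
  have [b [p [d [e {}P]]]] := pent_through P pg.
  wlog [def_b def_e] : b p d e P / b = t /\ e = w'.
    move=> IH; have [/and5P[yb _ _ _ ey] sP] := P; rewrite adj_sym in ey.
    have [bW eW] : b \in W /\ e \in W by split; apply: sP; rewrite !inE eqxx ?orbT.
    have eb := pent_diag girth5 (pent_rot (pent_rot (pent_rot (pent_rot P)))).
    case: (y_nbr b bW yb) => def_b; case: (y_nbr e eW ey) => def_e.
    + by rewrite def_b def_e eqxx in eb.
    + exact: IH P _.
    + exact: IH (pent_rev P) _.
    + by rewrite def_b def_e eqxx in eb.
  have pw' : p != w' by rewrite -def_e (pent_diag girth5 (pent_rot (pent_rot P))).
  have dy := pent_diag girth5 (pent_rot (pent_rot (pent_rot P))).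
  have [/and5P[_ tp pd de _] sP] := P; rewrite def_b in tp; rewrite def_e adj_sym in de.
  have [pW dW] : p \in W /\ d \in W by split; apply: sP; rewrite !inE eqxx ?orbT.
  have def_d : d = z by case: (w'_nbr d dW de) dy => // ->; rewrite eqxx.
  rewrite {}def_d in pd.
  have pK : p \in K0.
    case: (W_cases p pW) => // def_p; first by rewrite def_p (negPf nyz) in pd.
      by rewrite def_p adj_irr in tp.
    by rewrite def_p eqxx in pw'.
  have pA := UA p (K0U p pK).
  (* If [t] were [x], then [p] would be the common neighbour [w] of [x] and [z], whose colour [a y]
     is excluded from [U]. *)
  have [tx|tx] := eqVneq t x.
    rewrite tx in tp.
    have wp : w = p by apply: (common_nbr_uniq girth5 _ xw wz tp pd); rewrite eq_sym.
    by have := K0U p pK; rewrite inE -wp wy eqxx andbF.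
  exists t, p; split=> //; apply/negP.
    move=> /(edge_triple_sep tri tA)[] def_t; first by rewrite def_t eqxx in tx.
      by rewrite def_t adj_irr in yt.
    by rewrite def_t (negPf nyz) in yt.
  move=> /(edge_triple_sep tri pA)[] def_p.
  + by have := K0y p pK; rewrite def_p adj_sym xy_adj.
  + by move: yU; rewrite -def_p (K0U p pK).
  + by rewrite def_p adj_irr in pd.
have {none} none t' c' : t' \in U -> adj y t' -> c' \in K0 -> adj c' t' -> ~~ g t'.
  move=> t'U yt' c'K ct'; apply: contra none => gt'.
  by apply/existsP; exists t'; apply/existsP; exists c'; apply/and5P.
have gt := none t c tU yt cK ct.
(* All contacts with neighbours of [y] are now odd; one of them, [t], joins [y] to [K0] and makes
   [y] and [z] evenly connected. *)
apply: Or33; pose F := K0 :|: [set y; t].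
have K0F : K0 \subset F by apply: subsetUl.
have [yF tF] : y \in F /\ t \in F by rewrite !in_setU !in_set1 !eqxx ?orbT.
have F_cases v : v \in F -> [\/ v \in K0, v = y | v = t].
  rewrite !in_setU !in_set1 => /orP[vK|/orP[] /eqP]; first exact: Or31.
    exact: Or32.
  exact: Or33.
have F_U v : v \in F -> v != y -> v \in U by move/F_cases=> [/K0U|->|->]; rewrite ?eqxx.
exists F; split.
- by apply/subsetP=> v /F_cases[/K0U/UA|->|->] //; apply: UA.
- split=> //; first exact: (subsetP K0F).
    apply/negP=> /F_cases[/K0y|/eqP|def_t]; first by rewrite adj_sym xy_adj.
      by rewrite (negPf xy).
    by rewrite -def_t /g eqxx in gt.
  apply/negP=> /F_U wU; have : w \in U by apply: wU; apply: contraNneq nyz => <-.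
  by rewrite inE wy eqxx andbF.
(* A neighbour of [x] in [K0] would make [x] an even contact; if [t] were adjacent to [x], [x y t]
   would be a triangle. *)
- move=> v /F_cases[vK|//|->] xv.
    have := none x v xU _ vK; rewrite adj_sym => /(_ xy_adj); rewrite adj_sym => /(_ xv).
    by rewrite /g eqxx.
  rewrite adj_sym in yt; case: (triangle_free girth5 xv yt).
  by rewrite adj_sym.
- move=> v1 v2 v3 v4 v5 P.
  have pg : proper_on g (F :\ y).
    by move=> u v /setD1P[uy uF] /setD1P[vy vF]; apply: gU; apply: F_U.
  have [b [p [d [e {}P]]]] := pent_through P pg.
  have [/and5P[yb _ _ _ ey] sP] := P; rewrite adj_sym in ey.
  have eb := pent_diag girth5 (pent_rot (pent_rot (pent_rot (pent_rot P)))).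
  have y_nbr v : v \in F -> adj y v -> v = t.
    move=> /F_cases[vK|->|->] yv //; last by rewrite adj_irr in yv.
    by rewrite (negPf (K0y v vK)) in yv.
  have [bF eF] : b \in F /\ e \in F by split; apply: sP; rewrite !inE eqxx ?orbT.
  by rewrite (y_nbr b bF yb) (y_nbr e eF ey) eqxx in eb.
move=> f pf; have cF := subsetP K0F c cK.
have := gU c t (K0U c cK) tU ct; rewrite (negPf gt) => gc.
move: (parity f F c pf K0F cK) (pf _ _ cF tF ct) (pf _ _ yF tF yt) gc.
by case: (g c) (f z) (f c) (f t) (f y) => [] [] [] [] [].
Qed.

(** Inside [A], the strip [F'] adds at most [x] to [F], and [x] has at most the neighbour [y] there,
    so it is on no 5-cycle. *)
Lemma strips_side A B x y z w w' F F' : edge_triple A B x y z ->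
    strip A x y z w F -> strip B y x z w' F' ->
  forall v1 v2 v3 v4 v5 : G, ~ pent_in ((F :|: F') :&: A) v1 v2 v3 v4 v5.
Proof.
move=> tri [sFA [yF zF xF wF] x_nbr noP _] [/subsetP sFB [xF' zF' yF' _] _ _ _] v1 v2 v3 v4 v5 P.
have side v : v \in (F :|: F') :&: A -> v \in F \/ v = x.
  rewrite inE in_setU => /andP[/orP[|vF'] vA]; first by left.
  case: (edge_triple_sep tri vA (sFB v vF')) => def_v; [by right| |by left; rewrite def_v].
  by rewrite -def_v vF' in yF'.
have [xP|xP] := boolP (x \in [:: v1; v2; v3; v4; v5]); last first.
  apply: (noP v1 v2 v3 v4 v5); split; first exact: P.1.
  by move=> v vP; case: (side v (P.2 v vP)) => // def_v; rewrite -def_v vP in xP.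
have [b [c [d [e [{}P _]]]]] := pent_start P xP.
have eb := pent_diag girth5 (pent_rot (pent_rot (pent_rot (pent_rot P)))).
have [/and5P[xb _ _ _ ex] sP] := P; rewrite adj_sym in ex.
have to_y v : v \in [:: x; b; c; d; e] -> adj x v -> v = y.
  move=> /sP/side[vF|->]; first exact: x_nbr.
  by rewrite adj_irr.
have [bP eP] : b \in [:: x; b; c; d; e] /\ e \in [:: x; b; c; d; e].
  by rewrite !inE !eqxx ?orbT.
by rewrite (to_y b bP xb) (to_y e eP ex) eqxx in eb.
Qed.

(** A bipartition of the union would put [y] with [z] and [x] with [z], against the edge [xy]. A
    5-cycle would cross, with a middle vertex between two of [x], [y], [z]: this is [w] or [w'],
    both outside the union, or closes a triangle on [xy]. *)
Lemma strips_absurd A B x y z w w' F F' : edge_triple A B x y z ->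
    w \notin B -> adj x w -> adj w z -> w' \notin A -> adj y w' -> adj w' z ->
    strip A x y z w F -> strip B y x z w' F' -> False.
Proof.
move=> tri wB xw wz w'A yw' w'z sF sF'.
have tri' := edge_triple_swap_ends (edge_triple_swap_sides tri).
have sideA := strips_side tri sF sF'; have sideB := strips_side tri' sF' sF.
have [xy zx zy] := edge_triple_neq tri.
have [/subsetP sFA [yF zF xF wF] _ _ evF] := sF.
have [/subsetP sFB [xF' zF' yF' wF'] _ _ evF'] := sF'.
have [sAB defS xy_adj nxz nyz] := tri.
case: (bipartite_or_pent hG2 (F :|: F')) => [[f pf]|[v1 [v2 [v3 [v4 [v5 P]]]]]].
  have fyz : f y = f z by apply: evF => u v uF vF; apply: pf; rewrite in_setU (uF, vF).
  have fxz : f x = f z by apply: evF' => u v uF vF; apply: pf; rewrite in_setU ?uF ?vF orbT.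
  by have := pf x y; rewrite !in_setU xF' yF orbT fyz fxz eqxx => /(_ isT isT xy_adj).
have [||s [m [t [o [n [[Q sS tS] _]]]]]] := pent_crossing sAB P.
- move=> sA; apply: (sideA v1 v2 v3 v4 v5); split; first exact: P.1.
  by move=> v vP; rewrite inE sA // andbT; apply: P.2.
- move=> sB; apply: (sideB v1 v2 v3 v4 v5); split; first exact: P.1.
  by move=> v vP; rewrite inE sB // andbT setUC; apply: P.2.
have st := pent_diag girth5 Q; have [/and5P[sm mt _ _ _] sQ] := Q.
have mW : m \in F :|: F' by apply: sQ; rewrite !inE eqxx ?orbT.
have mid_xz : adj x m -> adj m z -> False.
  move=> xm mz; have mw : m = w by apply: (common_nbr_uniq girth5 _ xm mz xw wz); rewrite eq_sym.
  by move: mW; rewrite mw in_setU (negPf wF) => /sFB; rewrite (negPf wB).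
have mid_yz : adj y m -> adj m z -> False.
  move=> ym mz; have mw : m = w' by apply: (common_nbr_uniq girth5 _ ym mz yw' w'z); rewrite eq_sym.
  by move: mW; rewrite mw in_setU (negPf wF') orbF => /sFA; rewrite (negPf w'A).
have mid_xy : adj x m -> adj m y -> False.
  by move=> xm my; apply: (triangle_free girth5 xm my); rewrite adj_sym.
move: sS tS; rewrite defS !inE -!orbA.
case/or3P=> /eqP def_s; case/or3P=> /eqP def_t; move: st sm mt; rewrite def_s def_t ?eqxx //= => _ sm mt;
  first [exact: mid_xz sm mt | exact: mid_yz sm mt | exact: mid_xy sm mt
    | rewrite adj_sym in sm; rewrite adj_sym in mt;
      first [exact: mid_xz mt sm | exact: mid_yz mt sm | exact: mid_xy mt sm]].
Qed.

(** If [p] lies outside [A], the path [x p q z] is a link and [middle_and_link_absurd] applies.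
    Otherwise [p] is [y]. *)
Lemma opposite_core_absurd A B x y z a b w p q i j : edge_triple A B x y z ->
    proper_on a A -> proper_on b B -> a x = a z -> b y = b z ->
    i != a x -> i != a y -> j != b x -> j != b y ->
    w \in A -> adj x w -> adj w z -> a w != i ->
    p \in B -> q \in B -> adj x p -> adj p q -> adj q z -> b q != j -> False.
Proof.
move=> tri pa pb axz byz ix iy jx jy wA xw wz wi pB qB xp pq qz qj.
have tri' := edge_triple_swap_ends (edge_triple_swap_sides tri).
have [xA yA zA] := edge_triple_mem tri; have [yB xB zB] := edge_triple_mem tri'.
have [sAB defS xy_adj nxz nyz] := tri.
have axy : a x != a y by apply: pa.
have wy : a w = a y.
  apply: (@ord3_two_colors i _ (a x)) => //; first by rewrite eq_sym.
    by rewrite eq_sym.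
  by rewrite eq_sym; apply: pa.
have z_nbr (D E : {set G}) r : edge_triple D E x y z -> r \in D -> adj r z -> r \notin E.
  move=> triD rD rz; apply/negP=> rE.
  case: (edge_triple_sep triD rD rE) => def_r; move: rz; rewrite def_r ?adj_irr //; exact/negP.
have wB := z_nbr _ _ _ tri wA wz.
have qA := z_nbr _ _ _ (edge_triple_swap_sides tri) qB qz.
have [pA|pA] := boolP (p \in A); last first.
  exact: (middle_and_link_absurd tri pa pb axz wA xw wz wy pA qA xp pq qz).
case: (edge_triple_sep tri pA pB) => def_p; move: xp pq; rewrite def_p ?adj_irr //; last first.
  by rewrite (negPf nxz).
(* Now [q] is a common neighbour of [y] and [z] in [B], mirroring [w] in [A]. So [side_cases]
   applies to both sides, and only a pair of strips survives. *)
move=> _ yq; have qx : b q = b x.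
  apply: (@ord3_two_colors j _ (b y)) => //; try by rewrite eq_sym.
    by rewrite eq_sym; apply: pb.
  by rewrite eq_sym; apply: pb.
have [[a' [pa' zx' zy']]|[t [o [tB oB yt to oz]]]|[F sF]] :=
  side_cases tri pa axz wA xw wz wy qA yq qz.
- exact: (rainbow_absurd (edge_triple_swap_sides tri) pb pa').
- exact: (middle_and_link_absurd tri' pb pa byz qB yq qz qx tB oB yt to oz).
have [[b' [pb' zy' zx']]|[t [o [tA oA xt to oz]]]|[F' sF']] :=
  side_cases tri' pb byz qB yq qz qx wB xw wz.
- exact: (rainbow_absurd tri pa pb').
- exact: (middle_and_link_absurd tri pa pb axz wA xw wz wy tA oA xt to oz).
exact: (strips_absurd tri wB xw wz qA yq qz sF sF').
Qed.

(** The third colours [i] and [j] miss the separator. The bridge joins nonadjacent vertices coloured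
    alike on its short side only: [x] and [z] with the short path in [A], or [y] and [z] with it in
    [B]. *)
Lemma opposite_absurd A B x y z a b : edge_triple A B x y z ->
  proper_on a A -> proper_on b B -> a x = a z -> b y = b z -> False.
Proof.
move=> tri pa pb axz byz.
have tri' := edge_triple_swap_ends (edge_triple_swap_sides tri).
have [xA yA zA] := edge_triple_mem tri; have [yB xB zB] := edge_triple_mem tri'.
have [sAB defS xy_adj nxz nyz] := tri.
have axy : a x != a y by apply: pa.
have bxy : b x != b y by apply: pb.
have [i [ix iy]] := ord3_third (a x) (a y); have [j [jx jy]] := ord3_third (b x) (b y).
have eqS : {in A :&: B, forall s, (a s == i) = (b s == j)}.
  move=> s; rewrite defS !inE -orbA.
  by case/or3P=> /eqP->; rewrite -?axz -?byz ![_ == i]eq_sym ![_ == j]eq_sym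
    ?(negPf ix) ?(negPf iy) ?(negPf jx) ?(negPf jy).
have [s [m [t [o [n [[sS tS _ _] P br]]]]]] := bridge_of_common_class hG sAB pa pb eqS.
have st := pent_diag girth5 P; have [/and5P[sm mt to on ns] _] := P.
have [ms tm] : adj m s /\ adj t m by split; rewrite adj_sym.
have [ot no sn] : [/\ adj o t, adj n o & adj s n] by split; rewrite adj_sym.
have nst : adj s t = false by apply/negP=> /(triangle_free girth5 tm ms).
have nts : adj t s = false by rewrite adj_sym.
have coreA := opposite_core_absurd tri pa pb axz byz ix iy jx jy.
have coreB := opposite_core_absurd tri' pb pa byz axz jy jx iy ix.
move: sS tS; rewrite defS !inE -!orbA.
case/or3P=> /eqP def_s; case/or3P=> /eqP def_t; subst s t;
  rewrite ?eqxx // ?xy_adj // in st nst nts;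
  case: br => -[[mD oD nD] [mi oj nj eq_st ne_st]].
all: first [by rewrite ?axz ?byz eqxx in ne_st | by apply: (coreA m n o) | by apply: (coreA m o n)
  | by apply: (coreB m n o) | by apply: (coreB m o n)].
Qed.

(** With the classes of [y] matched, a bridge can only join [x] and [z], which neither colouring
    tells apart. *)
Lemma same_absurd A B x y z a b : edge_triple A B x y z ->
  proper_on a A -> proper_on b B -> a x = a z -> b x = b z -> False.
Proof.
move=> tri pa pb axz bxz.
have [xA yA zA] := edge_triple_mem tri.
have [xB yB zB] := edge_triple_mem (edge_triple_swap_sides tri).
have [sAB defS xy_adj nxz nyz] := tri.
have axy : a x != a y by apply: pa.
have bxy : b x != b y by apply: pb.
have eqS : {in A :&: B, forall s, (a s == a y) = (b s == b y)}.
  move=> s; rewrite defS !inE -orbA.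
  by case/or3P=> /eqP->; rewrite -?axz -?bxz ?eqxx // (negPf axy) (negPf bxy).
have [s [m [t [o [n [[sS tS as_ at_] P br]]]]]] := bridge_of_common_class hG sAB pa pb eqS.
have x_or_z v : v \in A :&: B -> a v != a y -> a v = a x /\ b v = b x.
  by rewrite defS !inE -orbA => /or3P[]/eqP->; rewrite ?eqxx // axz bxz.
have [asx bsx] := x_or_z s sS as_; have [atx btx] := x_or_z t tS at_.
by case: br => -[_ [_ _ _ _]]; rewrite ?asx ?atx ?bsx ?btx eqxx.
Qed.

Lemma edge_triple_absurd A B x y z : edge_triple A B x y z ->
  A != [set: G] -> B != [set: G] -> False.
Proof.
move=> tri neA neB; have triBA := edge_triple_swap_sides tri.
have triyx := edge_triple_swap_ends tri.
have [a pa] := G0_color_set hG neA; have [b pb] := G0_color_set hG neB.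
have not_rainbow (c : G -> 'I_3) : ~ (c z != c x /\ c z != c y) -> c x = c z \/ c y = c z.
  by have [|zx] := eqVneq (c z) (c x); [left | have [|zy] := eqVneq (c z) (c y); [right | case]].
have /not_rainbow a_cases : ~ (a z != a x /\ a z != a y).
  by case; apply: (rainbow_absurd triBA pb pa).
have /not_rainbow b_cases : ~ (b z != b x /\ b z != b y).
  by case; apply: (rainbow_absurd tri pa pb).
case: a_cases => axz; case: b_cases => bxz.
- exact: (same_absurd tri pa pb).
- exact: (opposite_absurd tri pa pb).
- exact: (opposite_absurd triyx pa pb).
- exact: (same_absurd triyx pa pb).
Qed.

End EdgeTriple.

(** * Cutsets and the final assembly *)

Lemma star_not_cutset (G : sgraph) (hG : G0 G) (u : G) (S : {set G}) :
  u \in S -> {in S, forall s, s = u \/ adj u s} -> ~ cutset S.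
Proof.
move=> uS star /cutset_separation[A [B [sAB defS neA neB]]].
by apply: (star_not_separator hG sAB neA neB (u := u)); rewrite defS.
Qed.

Theorem theorem1p3 (G : sgraph) (u : G) (hG : G0 G) :
  (forall x y : G, adj x y ->
     exists c : seq G, [/\ induced_cycle c, size c = 5 & cycle_edge c x y]) /\
  4 <= min_degree G /\
  k_connected 3 G /\
  (forall u1 u2 u3 : G,
     u1 \in nbhd u -> u2 \in nbhd u -> u3 \in nbhd u ->
     uniq [:: u1; u2; u3] -> ~ cutset [set u; u1; u2; u3]) /\
  (forall S : {set G}, #|S| = 3 -> cutset S -> stable S).
Proof.
have girth5 := G0_girth hG.
have order5 : 4 < #|G|.
  apply: leq_ltn_trans (degree_ge4 hG u) _; rewrite -cardsT; apply: proper_card.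
  by rewrite properT; apply/eqP=> /setP/(_ u); rewrite !inE adj_irr.
split=> [x y xy|].
  have [b [c [d P]]] := edge_in_pent hG xy; exists [:: x; y; b; c; d]; split=> //.
    exact: (pent_induced girth5 P).
  by rewrite /cycle_edge mem_head in_cons mem_head orbT /= !eqxx.
split.
  (* The default value [#|G|] of the minimum is the base case, covered by [order5]. *)
  rewrite /min_degree; elim/big_ind: _ => [|m n hm hn|v _]; first exact: ltnW.
    by rewrite leq_min hm.
  exact: degree_ge4.
split.
  split=> [|S lt3]; first exact: ltnW.
  have cut_absurd : ~ cutset S.
    move=> cutS; have [A [B [sAB defS neA neB]]] := cutset_separation cutS.
    (* For an empty separator any two classes agree and a bridge has no ends; a single vertex is a
       star. *)
    case: (set_0Vmem S) => [S0|[x xS]].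
      have [a pa] := G0_color_set hG neA; have [b pb] := G0_color_set hG neB.
      have eqS : {in A :&: B, forall s, (a s == ord0) = (b s == ord0)}.
        by rewrite defS S0 => s; rewrite inE.
      have [s [m [t [o [n [[]]]]]]] := bridge_of_common_class hG sAB pa pb eqS.
      by rewrite defS S0 inE.
    case: (set_0Vmem (S :\ x)) => [S1|[y]].
      apply: (star_not_cutset hG xS _ cutS) => s sS; left; apply/eqP.
      by have /setP/(_ s) := S1; rewrite !inE sS andbT => /negbFE.
    case/setD1P=> yx yS; have def : S = [set x; y].
      apply/esym/eqP; rewrite eqEcard subUset !sub1set xS yS /=.
      by rewrite cards2 eq_sym yx.
    by apply: (pair_not_separator hG sAB neA neB (x := x) (y := y)); rewrite ?defS // eq_sym.
  move=> x y; apply/negPn/negP=> nxy; apply: cut_absurd => conn.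
  by rewrite conn in nxy.
split.
  move=> u1 u2 u3; rewrite !inE => h1 h2 h3 _; apply: (star_not_cutset hG (u := u)).
    by rewrite !inE eqxx.
  by move=> s; rewrite !inE -!orbA => /or4P[]/eqP->; [left | right | right | right].
move=> S card3 cutS; apply/forall_inP=> x xS; apply/forall_inP=> y yS; apply/negP=> xy.
have [A [B [sAB defS neA neB]]] := cutset_separation cutS.
have xy_neq := adj_neq xy.
have [z zS] : exists z, z \in S :\: [set x; y].
  apply/set0Pn; rewrite -card_gt0 cardsD.
  have /setIidPr-> : [set x; y] \subset S by rewrite subUset !sub1set xS.
  by rewrite card3 cards2 xy_neq.
move: zS; rewrite !inE negb_or => /andP[/andP[zx zy] zS].
have def : S = [set x; y; z].
  apply/esym/eqP; rewrite eqEcard !subUset !sub1set xS yS zS /=.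
  by rewrite card3 setUC cardsU1 !inE negb_or zx zy cards2 xy_neq.
(* A second edge in [S] would make it a star centred at [x] or [y]. *)
have [xz|nxz] := boolP (adj x z).
  apply: (star_not_cutset hG xS _ cutS) => s; rewrite def !inE -orbA.
  by case/or3P=> /eqP->; [left | right | right].
have [yz|nyz] := boolP (adj y z).
  apply: (star_not_cutset hG yS _ cutS) => s; rewrite def !inE -orbA.
  by case/or3P=> /eqP->; [right; rewrite adj_sym | left | right].
by apply: (edge_triple_absurd hG _ neA neB (x := x) (y := y) (z := z)); split; rewrite // defS.
Qed.
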